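(* Let $n\in\mathbb{N}$ and $p\in(1,\infty)$. For $f\in L^p(\mathbb{R}^n)$ and $t>0$, define the truncated Hardy--Littlewood maximal operator $$M_tf(x):=\sup_{0<r\le t}\frac{1}{|B(x,r)|}\int_{B(x,r)}|f(y)|\,dy,\quad x\in\mathbb{R}^n.$$ Then, for every $f\in L^p(\mathbb{R}^n)$, $$\lim_{\alpha\to0^+}\alpha\int_0^1t^{\frac{\alpha p}{2}-1}\|M_tf\|_{L^p}^p\,dt=\frac{2}{p}\|f\|_{L^p}^p .$$
   Context: $B(x,r)$ denotes the open Euclidean ball in $\mathbb{R}^n$ with center $x$ and radius $r$, and $|B(x,r)|$ its $n$-dimensional Lebesgue measure. $L^p(\mathbb{R}^n)$ is the Lebesgue space with respect to Lebesgue measure, with norm $\|\cdot\|_{L^p}$. *)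

(* Defs.v *)
From HB Require Import structures.
From mathcomp Require Import all_boot all_order all_algebra.
From mathcomp Require Import all_classical all_reals all_analysis.

Set Implicit Arguments.
Unset Strict Implicit.
Unset Printing Implicit Defensive.

Import Order.TTheory GRing.Theory Num.Theory.
Import numFieldNormedType.Exports.

Local Open Scope classical_set_scope.
Local Open Scope ring_scope.
Local Open Scope ereal_scope.

Section product_lebesgue_step.
Context {R : realType} (n : nat).
Variable m : {sigma_finite_measure set (n.-tuple R) -> \bar R}.

Definition tuple_cons (x : measurableTypeR R * n.-tuple R) : n.+1.-tuple R :=
  [tuple of x.1 :: x.2].

Lemma measurable_tuple_cons : measurable_fun setT tuple_cons.
Proof. exact: measurable_cons. Qed.

HB.instance Definition _ :=
  isMeasurableFun.Build _ _ _ _ tuple_cons measurable_tuple_cons.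

Definition lebesgue_step : set (n.+1.-tuple R) -> \bar R :=
  pushforward (@lebesgue_measure R \x m) tuple_cons.

Let lebesgue_step0 : lebesgue_step set0 = 0.
Proof. exact: measure0. Qed.

Let lebesgue_step_ge0 A : 0 <= lebesgue_step A.
Proof. exact: measure_ge0. Qed.

Let lebesgue_step_sigma_additive : semi_sigma_additive lebesgue_step.
Proof. exact: measure_semi_sigma_additive. Qed.

HB.instance Definition _ := isMeasure.Build _ _ _ lebesgue_step
  lebesgue_step0 lebesgue_step_ge0 lebesgue_step_sigma_additive.

Let lebesgue_step_sigma_finite : sigma_finite setT lebesgue_step.
Proof.
have /sigma_finiteP[F [FT Fnd Foo]] := sigma_finiteT (@lebesgue_measure R).
have /sigma_finiteP[G [GT Gnd Goo]] := sigma_finiteT m.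
pose u (t : n.+1.-tuple R) : measurableTypeR R * n.-tuple R :=
  (thead t, [tuple of behead t]).
have uK : cancel tuple_cons u by case=> x t; congr pair => //; exact/val_inj.
have mu : measurable_fun setT u.
  apply/measurable_fun_pair; last exact: measurable_behead.
  exact: measurable_tnth.
exists (fun k => u @^-1` (F k `*` G k)).
  rewrite -preimage_bigcup; apply/esym/seteqP; split => // t _ /=.
  have [i _ Fi] : (\bigcup_k F k) (u t).1 by rewrite -FT.
  have [j _ Gj] : (\bigcup_k G k) (u t).2 by rewrite -GT.
  exists (maxn i j) => //; split.
  - by move: Fi; exact/subsetPset/Fnd/leq_maxl.
  - by move: Gj; exact/subsetPset/Gnd/leq_maxr.
move=> k; have [mF Fkoo] := Foo k; have [mG Gkoo] := Goo k; split.
  by rewrite -[X in measurable X]setTI; apply: mu => //; exact: measurableX.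
rewrite /lebesgue_step /pushforward -comp_preimage.
rewrite (_ : u \o tuple_cons = id); last exact/funext.
by rewrite preimage_id product_measure1E// lte_mul_pinfty// ge0_fin_numE.
Qed.

HB.instance Definition _ :=
  Measure_isSigmaFinite.Build _ _ _ lebesgue_step lebesgue_step_sigma_finite.

End product_lebesgue_step.

(* The n-fold product of [lebesgue_measure], on the Borel sets of R^n. *)
Fixpoint product_lebesgue (R : realType) (n : nat) :
    {sigma_finite_measure set (n.-tuple R) -> \bar R} :=
  match n with
  | 0%N => \d_([tuple] : 0.-tuple R)
  | n'.+1 => lebesgue_step (product_lebesgue R n')
  end.

Lemma product_lebesgue_box (R : realType) (n : nat) (A : 'I_n -> set R) :
  (forall i, measurable (A i)) ->
  product_lebesgue R n [set x | forall i, A i (tnth x i)] =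
  \prod_(i < n) lebesgue_measure (A i).
Proof.
elim: n A => [|n IH] A mA.
  by rewrite big_ord0 /= diracE mem_set// => -[].
pose B := [set t : n.-tuple R | forall i, A (lift ord0 i) (tnth t i)].
have mB : measurable B.
  rewrite (_ : B = \bigcap_(i in [set: 'I_n])
      ((fun t : n.-tuple R => tnth t i) @^-1` A (lift ord0 i))).
    apply: fin_bigcap_measurable => // i _; rewrite -[X in measurable X]setTI.
    exact: measurable_tnth.
  by apply/seteqP; split => [t Bt i _|t Bt i]; [exact: Bt|exact: (Bt i I)].
rewrite big_ord_recl -(IH (fun i => A (lift ord0 i)))// -/B -product_measure1E//;
  last exact: (mA ord0).
rewrite /= /lebesgue_step /pushforward; congr (_ _).
apply/seteqP; split => -[x t] /= At.
  by split=> [|i]; [exact: (At ord0)|have := At (lift ord0 i); rewrite tnthS].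
case: At => Ax At i; case: (unliftP ord0 i) => [j|] -> //.
by rewrite tnthS; exact: At.
Qed.

(* R^n with the sigma-algebra of its Lebesgue measurable sets, and the Lebesgue
   measure on it: the completion of the product measure. *)
Definition Rn (R : realType) (n : nat) : measurableType _ :=
  caratheodory_type ((product_lebesgue R n)^*)%mu.

Definition lebesgue_Rn (R : realType) (n : nat) : set (Rn R n) -> \bar R :=
  @completed_measure_extension _ _ _ (product_lebesgue R n).

HB.instance Definition _ (R : realType) (n : nat) :=
  Measure.on (@lebesgue_Rn R n).

Lemma lebesgue_Rn_sigma_finite (R : realType) (n : nat) :
  sigma_finite setT (@lebesgue_Rn R n).
Proof. exact/completed_measure_extension_sigma_finite/sigma_finiteT. Qed.

HB.instance Definition _ (R : realType) (n : nat) :=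
  Measure_isSigmaFinite.Build _ _ _ (@lebesgue_Rn R n)
    (@lebesgue_Rn_sigma_finite R n).

Definition euclidean_ball (R : realType) (n : nat) (x : Rn R n) (r : R) :
    set (Rn R n) :=
  [set y | (Num.sqrt (\sum_(i < n) (tnth x i - tnth y i) ^+ 2) < r)%R].

Definition truncated_HL_maximal (R : realType) (n : nat) (t : R)
    (f : Rn R n -> R) (x : Rn R n) : \bar R :=
  ereal_sup [set (lebesgue_Rn (euclidean_ball x r))^-1 *
      \int[@lebesgue_Rn R n]_(y in euclidean_ball x r) `|f y|%:E
    | r in `]0%R, t]].

(* Main.v *)
Require Import Defs.
From mathcomp Require Import all_boot all_order all_algebra.
From mathcomp Require Import all_classical all_reals all_analysis.
From mathcomp Require Import measurable_realfun ring lra.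

Set Implicit Arguments.
Unset Strict Implicit.
Unset Printing Implicit Defensive.

Import Order.TTheory GRing.Theory Num.Theory.
Import numFieldNormedType.Exports.

Local Open Scope classical_set_scope.
Local Open Scope ring_scope.
Local Open Scope ereal_scope.

(* Let N(t) = ||M_t f||_p^p. The maximal inequality makes N(1) finite, and Lebesgue's
   differentiation theorem gives M_t f -> |f| almost everywhere, so N(t) decreases to
   ||f||_p^p as t -> 0+ by dominated convergence. The weight alpha t^(alpha p/2 - 1) has
   mass 2/p on ]0,1[ and concentrates at 0 as alpha -> 0+.

   The weak (1,1) inequality is obtained from a Vitali selection among rational cubes
   (the inclusions of cube(x, r/n) in B(x,r) and of B(x,r) in cube(x,r) replace the exact
   value of |B(x,r)|), the strong one from it by truncation and the layer-cake formula. For the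
   differentiation theorem, the weak inequality reduces L^1 functions to indicators of
   Borel sets, which are handled by Dynkin induction from half-spaces. *)

(** * Measurability and volume of balls and cubes *)

Section geometry.
Context {R : realType} (n : nat).
Local Notation mu := (@lebesgue_Rn R n).

(** Density of continuous functions is not invoked: its place is taken by Borel sets with null
    boundary, and the weak inequality carries differentiability almost everywhere through L^1
    limits. Since [Rn] carries the completed sigma-algebra, the Borel case is transferred to
    Lebesgue measurable sets by covering from outside. Radii up to 1 suffice for the final integral,
    and bounded radii are what the Vitali selection asks for. Cubes with rational data are countably
    many, so the covering argument ends with countable subadditivity. The supremum defining M_t f
    runs over uncountably many radii; its strict superlevel sets are the handle on it, both for
    measurability and for the estimates. In the final limit, |f| <= M_t f almost everywhere gives
    the lower bound for every alpha > 0. For the upper bound, ]0,1[ is cut at a point d where N(d)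
    is close to its limit; since the weight without its factor alpha is at most 1/d beyond d, that
    part contributes at most alpha N(1)/d. *)

Lemma measurable_Rn_Borel (A : set (n.-tuple R)) :
  measurable A -> measurable (A : set (Rn R n)).
Proof. exact: caratheodory_measurable_mu_ext. Qed.

Lemma lebesgue_Rn_Borel (A : set (n.-tuple R)) :
  measurable A -> mu A = product_lebesgue R n A.
Proof. exact: measurable_mu_extE. Qed.

Lemma measurable_fun_tnth_Rn (i : 'I_n) :
  measurable_fun [set: Rn R n] (fun x : Rn R n => tnth x i).
Proof.
move=> _ Y mY; rewrite setTI; apply: measurable_Rn_Borel.
by rewrite -[X in measurable X]setTI; exact: (@measurable_tnth _ (measurableTypeR R)).
Qed.

Lemma measurable_box (A : 'I_n -> set R) : (forall i, measurable (A i)) ->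
  measurable [set x : n.-tuple R | forall i, A i (tnth x i)].
Proof.
move=> mA; rewrite (_ : [set x | _] = \bigcap_(i in [set: 'I_n])
      ((fun t : n.-tuple R => tnth t i) @^-1` A i)).
  apply: fin_bigcap_measurable => // i _; rewrite -[X in measurable X]setTI.
  exact: measurable_tnth.
by apply/seteqP; split => [t Bt i _|t Bt i]; [exact: Bt|exact: (Bt i I)].
Qed.

Definition cube (x : Rn R n) (r : R) : set (Rn R n) :=
  [set y | forall i, (`|tnth x i - tnth y i| < r)%R].

Lemma cube_box x r :
  cube x r = [set y | forall i, ball (tnth x i) r (tnth y i)].
Proof. by apply/seteqP; split => y h i; exact: h. Qed.

Lemma measurable_cube x r : measurable (cube x r).
Proof.
rewrite cube_box; apply: measurable_Rn_Borel.
by apply: (@measurable_box (fun i => ball (tnth x i) r)) => i; exact: measurable_ball.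
Qed.

Lemma lebesgue_Rn_cube x r : (0 <= r)%R -> mu (cube x r) = ((r *+ 2) ^+ n)%:E.
Proof.
move=> r0; have mB i : measurable (ball (tnth x i) r) by exact: measurable_ball.
rewrite cube_box lebesgue_Rn_Borel; last exact: (measurable_box mB).
rewrite (@product_lebesgue_box R n (fun i => ball (tnth x i) r))//.
under eq_bigr => i _ do rewrite lebesgue_measure_ball//.
by rewrite prodEFin prodr_const card_ord.
Qed.

(** Joint measurability in the center and the point is what Tonelli's theorem needs to make ball
    integrals measurable in the center. *)
Lemma measurable_euclidean_ball_rel r :
  measurable [set z : Rn R n * Rn R n | euclidean_ball z.1 r z.2].
Proof.
pose d (z : Rn R n * Rn R n) :=
  Num.sqrt (\sum_(i < n) (tnth z.1 i - tnth z.2 i) ^+ 2)%R.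
have md : measurable_fun setT d.
  apply: (measurableT_comp (f := @Num.sqrt R)).
    by apply: continuous_measurable_fun => ?; exact: sqrt_continuous.
  apply: measurable_sum => i; apply: measurable_funX; apply: measurable_funB.
    exact: (measurableT_comp (measurable_fun_tnth_Rn i)).
  exact: (measurableT_comp (measurable_fun_tnth_Rn i)).
rewrite (_ : [set z | _] = d @^-1` `]-oo, r[%classic).
  by rewrite -[X in measurable X]setTI; apply: md.
by apply/seteqP; split => z /=; rewrite in_itv.
Qed.

Lemma measurable_euclidean_ball x r :
  measurable (euclidean_ball x r : set (Rn R n)).
Proof.
have /(measurable_xsection x) := measurable_euclidean_ball_rel r.
by congr measurable; apply/seteqP; split => y; rewrite /xsection /= inE.
Qed.

Lemma euclidean_ball_sub_cube x r : euclidean_ball x r `<=` cube x r.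
Proof.
move=> y /= h i; apply: le_lt_trans h.
rewrite -sqrtr_sqr ler_wsqrtr// (bigD1 i)//= lerDl sumr_ge0// => j _.
exact: sqr_ge0.
Qed.

(** Each of the [n] squares is below [(r / n)^2], so their sum is below [r^2 / n <= r^2]. That the
    cube contains [y] already forces [0 < r]. *)
Lemma cube_sub_euclidean_ball x r : (0 < n)%N ->
  cube x (r / n%:R) `<=` euclidean_ball x r.
Proof.
move=> n0 y h /=.
have n0' : (0 < n%:R :> R)%R by rewrite ltr0n.
have r0 : (0 < r)%R.
  have := le_lt_trans (normr_ge0 _) (h (Ordinal n0)).
  by rewrite pmulr_lgt0// invr_gt0.
rewrite /euclidean_ball /= -(gtr0_norm r0) -sqrtr_sqr ltr_sqrt ?exprn_gt0//.
apply: (@lt_le_trans _ _ (\sum_(i < n) (r / n%:R) ^+ 2)%R).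
  apply: ltr_sum => [|i _]; first by apply/hasP; exists (Ordinal n0) => //; rewrite mem_index_enum.
  by rewrite -(real_normK (num_real _)) ltr_sqr ?nnegrE// ?divr_ge0// ltW.
rewrite sumr_const card_ord -[leLHS]mulr_natl expr_div_n.
rewrite mulrC -mulrA ler_piMr ?sqr_ge0// expr2 invfM mulfVK ?gt_eqF//.
by rewrite invf_le1// ler1n.
Qed.

End geometry.

(** * Measurability of the maximal function *)

Section maximal_measurability.
Context {R : realType} (n : nat).
Hypothesis n_gt0 : (0 < n)%N.
Local Notation mu := (@lebesgue_Rn R n).
Implicit Types (f : Rn R n -> R) (x : Rn R n) (r t : R).

Lemma euclidean_ball_le x r s : (r <= s)%R ->
  euclidean_ball x r `<=` euclidean_ball x s.
Proof. by move=> rs y /= xy; exact: lt_le_trans rs. Qed.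

Lemma lebesgue_Rn_euclidean_ball_fin x r : mu (euclidean_ball x r) \is a fin_num.
Proof.
rewrite ge0_fin_numE ?measure_ge0//.
have [r0|r0] := leP 0%R r.
  apply: (@le_lt_trans _ _ (mu (cube x r))).
    apply: le_measure; rewrite ?inE.
    - exact: measurable_euclidean_ball.
    - exact: measurable_cube.
    - exact: euclidean_ball_sub_cube.
  by rewrite lebesgue_Rn_cube// ltry.
rewrite (_ : euclidean_ball x r = set0) ?measure0//.
by apply/seteqP; split => // y /(le_lt_trans (sqrtr_ge0 _)); rewrite ltNge ltW.
Qed.

Lemma lebesgue_Rn_euclidean_ball_ge x r : (0 <= r)%R ->
  (((r / n%:R) *+ 2) ^+ n)%:E <= mu (euclidean_ball x r).
Proof.
move=> r0; rewrite -(lebesgue_Rn_cube x) ?divr_ge0//; apply: le_measure; rewrite ?inE.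
- exact: measurable_cube.
- exact: measurable_euclidean_ball.
- exact: cube_sub_euclidean_ball.
Qed.

Lemma lebesgue_Rn_euclidean_ball_gt0 x r : (0 < r)%R ->
  0 < mu (euclidean_ball x r).
Proof.
move=> r0; apply: lt_le_trans (lebesgue_Rn_euclidean_ball_ge _ (ltW r0)).
by rewrite lte_fin exprn_gt0// mulrn_wgt0// divr_gt0// ltr0n.
Qed.

Lemma lte_average f x r (l : \bar R) : (0 < r)%R ->
  (l < (mu (euclidean_ball x r))^-1 *
         \int[mu]_(y in euclidean_ball x r) `|f y|%:E) =
  (mu (euclidean_ball x r) * l < \int[mu]_(y in euclidean_ball x r) `|f y|%:E).
Proof.
move=> r0; have := lebesgue_Rn_euclidean_ball_gt0 x r0.
have := lebesgue_Rn_euclidean_ball_fin x r.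
case: (mu (euclidean_ball x r)) => // v _; rewrite lte_fin => v0.
by rewrite inver gt_eqF// lte_pdivlMl.
Qed.

(** A strict inequality below a supremum is witnessed by a single radius; multiplying by the measure
    of the ball, positive and finite, removes the extended-real inverse. *)
Lemma gt_truncated_HL_maximal t f x (l : \bar R) :
  l < truncated_HL_maximal t f x <->
  exists2 r, (0 < r <= t)%R &
    mu (euclidean_ball x r) * l < \int[mu]_(y in euclidean_ball x r) `|f y|%:E.
Proof.
split=> [/ereal_sup_gt[_ [r /= +] <-]|[r /andP[r0 rt] lr]].
  by rewrite in_itv/= => /andP[r0 rt]; rewrite lte_average// => lr; exists r; rewrite ?r0.
rewrite -lte_average// in lr; apply: (lt_le_trans lr).
by apply: ereal_sup_ubound; exists r => //=; rewrite in_itv/= r0.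
Qed.

(** Tonelli's theorem for [|f y|] times the indicator of the relation [|x - y| < r] on the product
    space. *)
Lemma measurable_integral_euclidean_ball f r : measurable_fun setT f ->
  measurable_fun setT
    (fun x => \int[mu]_(y in euclidean_ball x r) `|f y|%:E).
Proof.
move=> mf.
pose F := (fun z : Rn R n * Rn R n => `|f z.2|%:E)
  \_ [set z | euclidean_ball z.1 r z.2].
have mF : measurable_fun setT F.
  apply/(measurable_restrictT _ (measurable_euclidean_ball_rel r)).
  apply: measurable_funTS; apply/measurable_EFinP; apply: measurableT_comp => //.
  exact: measurableT_comp.
have F0 z : 0 <= F z by apply: erestrict_ge0.
have := measurable_fun_fubini_tonelli_F (m2 := mu) F mF F0.
congr measurable_fun; apply/funext => x.
rewrite /fubini_F [RHS]integral_mkcond; apply: eq_integral => y _.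
by rewrite /F !patchE; congr (if _ then _ else _); apply/idP/idP; rewrite !inE.
Qed.

Lemma measurable_lebesgue_euclidean_ball r :
  measurable_fun setT (fun x => mu (euclidean_ball x r)).
Proof.
have := @measurable_integral_euclidean_ball (cst 1%R) r (measurable_cst _).
congr measurable_fun; apply/funext => x.
rewrite /= normr1 integral_cst ?mul1e//; exact: measurable_euclidean_ball.
Qed.

(* Open balls make the integral left-continuous in the radius, so that rational
   radii suffice. *)
Lemma gt_truncated_HL_maximal_rat t f (l : R) : measurable_fun setT f ->
  [set x | l%:E < truncated_HL_maximal t f x] =
  \bigcup_(q in [set q : rat | (0 < (ratr q : R) <= t)%R])
    [set x | mu (euclidean_ball x (ratr q)) * l%:E <
       \int[mu]_(y in euclidean_ball x (ratr q)) `|f y|%:E].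
Proof.
move=> mf; have mfE A : measurable_fun A (fun y => `|f y|%:E).
  by apply: measurable_funTS; apply/measurable_EFinP; exact: measurableT_comp.
apply/seteqP; split => x /=; last first.
  by move=> [q /= qt lq]; apply/gt_truncated_HL_maximal; exists (ratr q).
move=> /gt_truncated_HL_maximal[r /andP[r0 rt] lr].
(* For negative [l] the left side decreases as the ball grows, so the comparison of radii below
   would fail; but then every radius qualifies, the left side being negative and the integral
   non-negative. *)
have [l0|l0] := ltP l 0%R.
  have [q] := rat_in_itvoo r0; rewrite in_itv/= => /andP[q0 qr].
  exists q => /=; first by rewrite q0 (le_trans (ltW qr)).
  apply: (@lt_le_trans _ _ 0); last by apply: integral_ge0.
  rewrite mule_gt0_lt0 ?lte_fin//; exact: lebesgue_Rn_euclidean_ball_gt0.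
pose F k := euclidean_ball x (r - r / k.+1%:R).
have FE : \bigcup_k F k = euclidean_ball x r.
  apply/seteqP; split => y.
    move=> [k _]; apply: euclidean_ball_le.
    by rewrite gerBl divr_ge0// ltW.
  rewrite /euclidean_ball /= => xy; set d := Num.sqrt _ in xy.
  have dr : (0 < (r - d) / r)%R by rewrite divr_gt0// subr_gt0.
  have [k _ /(_ k (leqnn _)) kd] := near_infty_natSinv_lt (PosNum dr).
  exists k => //; rewrite /F /euclidean_ball /= -/d.
  move: kd => /=; rewrite ltr_pdivlMr// mulrC => kd.
  by rewrite ltrBrDl -ltrBrDr.
have : \int[mu]_(y in F k) `|f y|%:E @[k --> \oo] -->
       \int[mu]_(y in \bigcup_k F k) `|f y|%:E.
  apply: ge0_nondecreasing_set_cvg_integral => //.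
  - apply/nondecreasing_seqP => k; apply/subsetPset; apply: euclidean_ball_le.
    by rewrite lerD2l lerN2 ler_pM2l// lef_pV2 ?posrE// ler_nat.
  - by move=> k; exact: measurable_euclidean_ball.
rewrite FE => /cvg_lim/= FL.
have [k lk] : exists k, mu (euclidean_ball x r) * l%:E < \int[mu]_(y in F k) `|f y|%:E.
  apply: contrapT => /forallNP h.
  move: lr; rewrite ltNge => /negP; apply; rewrite -FL//.
  apply: lime_le.
    apply: ereal_nondecreasing_is_cvgn; apply/nondecreasing_seqP => k.
    apply: ge0_subset_integral => //; try exact: measurable_euclidean_ball.
    apply: euclidean_ball_le.
    by rewrite lerD2l lerN2 ler_pM2l// lef_pV2 ?posrE// ler_nat.
  by apply: nearW => k; have /negP := h k; rewrite -leNgt.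
have kr : (r - r / k.+1%:R < r)%R by rewrite gtrBl divr_gt0.
(* For [q] between these radii the integral is at least the one over [F k], while the measure is at
   most that of the ball of radius [r]. *)
have [q] := rat_in_itvoo kr; rewrite in_itv/= => /andP[kq qr].
have q0 : (0 < ratr q :> R)%R.
  apply: le_lt_trans kq; by rewrite subr_ge0 ler_pdivrMr// ler_peMr ?ler1n// ltW.
exists q => /=; first by rewrite q0 (le_trans (ltW qr)).
apply: (@le_lt_trans _ _ (mu (euclidean_ball x r) * l%:E)).
  rewrite lee_wpmul2r ?lee_fin//; apply: le_measure; rewrite ?inE;
    [exact: measurable_euclidean_ball..|exact/euclidean_ball_le/ltW].
apply: (lt_le_trans lk); apply: ge0_subset_integral => //;
  [exact: measurable_euclidean_ball..|exact/euclidean_ball_le/ltW].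
Qed.

Lemma measurable_truncated_HL_maximal t f : measurable_fun setT f ->
  measurable_fun setT (truncated_HL_maximal t f).
Proof.
move=> mf; apply: (measurability _ (ErealGenOInfty.measurableE R)) => _ [_ [r ->] <-].
rewrite setTI (_ : _ @^-1` _ = [set x | r%:E < truncated_HL_maximal t f x]); last first.
  by apply/seteqP; split => x /=; rewrite in_itv/= andbT.
have mQ q : measurable [set x | mu (euclidean_ball x (ratr q)) * r%:E <
    \int[mu]_(y in euclidean_ball x (ratr q)) `|f y|%:E].
  rewrite -[X in measurable X]setTI.
  apply: measurable_lte.
  - exact: measurableT.
  - apply: emeasurable_funM; [exact: measurable_lebesgue_euclidean_ball|].
    exact: measurable_cst.
  - exact: measurable_integral_euclidean_ball.
rewrite gt_truncated_HL_maximal_rat// bigcup_mkcond.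
apply: bigcupT_measurable_rat => q.
case: (q \in _).
exact: mQ.
exact: measurable0.
Qed.

End maximal_measurability.

(** * The Vitali selection and the weak (1,1) inequality *)

(** Zorn's lemma yields a maximal disjoint family. If some set failed the conclusion, one could add
    a set disjoint from the family whose radius exceeds half the supremum over all such sets. The
    statement is combinatorial; geometry enters only when it is applied. *)
Lemma vitali_selection (R : realType) (T I : Type) (B : I -> set T)
    (rad : I -> R) (M : R) (V : set I) :
  (forall i, V i -> (0 < rad i <= M)%R) -> (forall i, V i -> B i !=set0) ->
  exists D : set I, [/\ D `<=` V, trivIset D B &
    forall i, V i -> exists j,
      [/\ D j, B i `&` B j !=set0 & (rad i <= 2 * rad j)%R]].
Proof.
move=> radV BV.
have emp (A : set T) : ~ (A !=set0) -> A = set0.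
  by move=> A0; apply/seteqP; split => // z Az; apply: A0; exists z.
(* The size condition concerns only the sets that meet some member of [u]: so the empty family
   satisfies it, and it passes to unions of chains. Maximality then makes every set meet the
   family. *)
pose P := [set u : set I | [/\ u `<=` V, trivIset u B &
  forall a b, V a -> u b -> B a `&` B b !=set0 ->
    exists c, [/\ u c, B a `&` B c !=set0 & (rad a <= 2 * rad c)%R]]].
have [|D [[DV tD maxD] Dmax]] := @Zorn_bigcup _ P.
  move=> F FP Ftot; split.
  - by move=> i [u Fu ui]; have [uV _ _] := FP _ Fu; exact: uV.
  - move=> i j [u Fu ui] [v Fv vj].
    have [uv|vu] := Ftot _ _ Fu Fv.
      by have [_ tv _] := FP _ Fv; apply: tv => //; exact: uv.
    by have [_ tu _] := FP _ Fu; apply: tu => //; exact: vu.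
  - move=> a b Va [u Fu ub] ab; have [_ _ h] := FP _ Fu.
    by have [c [uc ac rac]] := h _ _ Va ub ab; exists c; split => //; exists u.
exists D; split => // a Va; apply: contrapT => na.
(* The sets disjoint from the whole family. The set [a] is one of them: had it met a member, the
   size condition would give it the required partner. *)
pose A' := [set x | V x /\ forall c, D c -> B x `&` B c = set0].
have A'a : A' a.
  split => // c Dc; apply: emp => ac; apply: na.
  by have [d [Dd ad rd]] := maxD a c Va Dc ac; exists d.
have supA : has_sup [set rad x | x in A'].
  split; first by exists (rad a), a.
  by exists M => _ [x [Vx _] <-]; have /andP[] := radV x Vx.
have supA_gt0 : (0 < sup [set rad x | x in A'])%R.
  have /andP[ra _] := radV a Va; apply: (lt_le_trans ra).
  by apply: ub_le_sup; [exact: supA.2|exists a].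
have [_ [a' [Va' a'D] <-] a'sup] :
    exists2 y, [set rad x | x in A'] y & (sup [set rad x | x in A'] / 2 < y)%R.
  have /(@sup_adherent _ _ _) : (0 < sup [set rad x | x in A'] / 2)%R by rewrite divr_gt0.
  move=> /(_ _ supA)[y Ay ysup]; exists y => //; apply: le_lt_trans ysup; lra.
have nDa' : ~ D a'.
  move=> /a'D; rewrite setIid => Ba'0.
  by have [z] := BV _ Va'; rewrite Ba'0.
apply: (Dmax (D `|` [set a'])).
  split; first exact: subsetUl.
  by move=> /(_ a') h; apply/nDa'/h; right.
split.
- by move=> i [/DV//|->].
- move=> i j [Di|->] [Dj|->] ij //; first exact: tD.
    by move: ij; rewrite setIC (a'D _ Di) => -[].
  by move: ij; rewrite (a'D _ Dj) => -[].
- move=> x b Vx + xb.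
  have [[c Dc xc]|nx] := pselect (exists2 c, D c & B x `&` B c !=set0).
    by move=> _; have [d [Dd xd rd]] := maxD x c Vx Dc xc; exists d; split => //; left.
  move=> [Db|bE]; first by exfalso; apply: nx; exists b.
  rewrite bE in xb; exists a'; split => //; first by right.
  (* As [x] meets no old member it belongs to [A'], so its radius is at most the supremum, hence
     below twice that of [a']. *)
  have : (rad x <= sup [set rad x | x in A'])%R.
    apply: ub_le_sup; first exact: supA.2.
    exists x => //; split => // c Dc; apply: emp => xc.
    by apply: nx; exists c.
  move=> xsup; rewrite (le_trans xsup)//; lra.
Qed.

Section weak_type.
Context {R : realType} (n : nat).
Hypothesis n_gt0 : (0 < n)%N.
Local Notation mu := (@lebesgue_Rn R n).

Lemma rat_point_near (x : Rn R n) (e : R) : (0 < e)%R ->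
  exists q : n.-tuple rat, cube x e [tuple ratr (tnth q i) | i < n].
Proof.
move=> e0.
have /fin_all_exists[q hq] (i : 'I_n) : exists q : rat, (`|tnth x i - ratr q| < e)%R.
  have /rat_in_itvoo[q] : (tnth x i - e < tnth x i + e)%R by lra.
  rewrite in_itv/= => /andP[h1 h2]; exists q; rewrite ltr_distlC; apply/andP; split; lra.
by exists [tuple q i | i < n] => i; rewrite !tnth_mktuple.
Qed.

(** An enumeration of the cubes with rational center and radius. Numbers that code nothing get
    radius 0 and are excluded later by requiring a positive radius. *)
Let code (k : nat) : n.-tuple rat * rat := odflt ([tuple 0%R | i < n], 0%R) (unpickle k).
Let ctr (k : nat) : Rn R n := [tuple ratr (tnth (code k).1 i) | i < n].
Let rad (k : nat) : R := ratr (code k).2.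

(** The constant is [10 n = 5 * (2 n)]: the factor 5 is the Vitali dilation, and [2 n] compares a
    rational cube of half-side below [2 r] with the cube of half-side [r / n] inside the ball. Since
    [t <= 1], the half-sides are bounded by 2. *)
Lemma HL_maximal_weak_type (t l : R) (f : Rn R n -> R) :
  measurable_fun setT f -> (t <= 1)%R -> (0 < l)%R ->
  mu [set x | l%:E < truncated_HL_maximal t f x] <=
    ((10 * n%:R) ^+ n / l)%:E * \int[mu]_y `|f y|%:E.
Proof.
move=> mf t1 l0.
have n0 : (0 < n%:R :> R)%R by rewrite ltr0n.
have mfE A : measurable_fun A (fun y => `|f y|%:E).
  by apply: measurable_funTS; apply/measurable_EFinP; exact: measurableT_comp.
pose V := [set k | (0 < rad k <= 2)%R /\
   mu (cube (ctr k) (rad k)) <=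
     (((2 * n%:R) ^+ n) / l)%:E * \int[mu]_(y in cube (ctr k) (rad k)) `|f y|%:E].
have EV : [set x | l%:E < truncated_HL_maximal t f x] `<=`
    \bigcup_(k in V) cube (ctr k) (rad k).
  move=> x /= /(gt_truncated_HL_maximal n_gt0)[r /andP[r0 rt] lr].
  have r2 : (0 < r / 2)%R by rewrite divr_gt0.
  (* A center within [r / 2] of [x] in each coordinate and a half-side above [r / 2 + r] ensure that
     the cube contains the ball. *)
  have [q qx] := rat_point_near x r2.
  have /rat_in_itvoo[s] : (r * (3 / 2) < r * 2)%R by lra.
  rewrite in_itv/= => /andP[s1 s2].
  have [k kE] : exists k, code k = (q, s).
    by exists (pickle (q, s)); rewrite /code pickleK.
  have ctrE : ctr k = [tuple ratr (tnth q i) | i < n] by rewrite /ctr kE.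
  have radE : rad k = ratr s by rewrite /rad kE.
  rewrite -ctrE in qx.
  have xk y : euclidean_ball x r y -> cube (ctr k) (rad k) y.
    move=> /euclidean_ball_sub_cube xy i; have := xy i; have := qx i.
    rewrite radE !ltr_distlC => /andP[a1 a2] /andP[b1 b2].
    by apply/andP; split; lra.
  exists k; last first.
    apply: xk; rewrite /euclidean_ball /= big1 ?sqrtr0// => i _.
    by rewrite subrr expr0n.
  split; first by rewrite radE; apply/andP; split; lra.
  rewrite lebesgue_Rn_cube; last by rewrite radE; lra.
  rewrite -lee_pdivrMl; last first.
    by rewrite divr_gt0// exprn_gt0// mulr_gt0.
  apply: (@le_trans _ _ (\int[mu]_(y in euclidean_ball x r) `|f y|%:E)); last first.
    apply: ge0_subset_integral => //; [exact: measurable_euclidean_ball|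
      exact: measurable_cube].
  apply: (le_trans _ (ltW lr)).
  apply: (@le_trans _ _ ((((r / n%:R) *+ 2) ^+ n)%:E * l%:E)); last first.
    apply: lee_wpmul2r; first by rewrite lee_fin ltW.
    exact: (lebesgue_Rn_euclidean_ball_ge n_gt0 _ (ltW r0)).
  rewrite -!EFinM lee_fin invf_div mulrAC.
  rewrite ler_pdivrMr; last by rewrite exprn_gt0// mulr_gt0.
  rewrite [leLHS]mulrC [leRHS]mulrAC ler_pM2r// -exprMn ler_pXn2r// ?nnegrE.
  - rewrite radE [leRHS](_ : _ = (r * 4)%R); last by field; rewrite gt_eqF.
    lra.
  - by rewrite radE mulrn_wge0//; lra.
  - by rewrite mulr_ge0 ?mulrn_wge0 ?divr_ge0 ?mulr_ge0// ltW.
have radV k : V k -> (0 < rad k <= 2)%R by case.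
have cubeV k : V k -> cube (ctr k) (rad k) !=set0.
  by move=> [/andP[r0 _] _]; exists (ctr k) => i; rewrite subrr normr0.
have [D [DV tD maxD]] := vitali_selection radV cubeV.
(* A cube of half-side at most [2 rad j] that meets the cube [j] lies within
   [2 (2 rad j) + rad j = 5 rad j] of its center. Empty sets outside [D] let the sums run over all
   of [nat]. *)
pose F k := if k \in D then cube (ctr k) (5 * rad k) else set0.
pose G k := if k \in D then cube (ctr k) (rad k) else set0.
have mF k : measurable (F k) by rewrite /F; case: ifP => // _; exact: measurable_cube.
have mG k : measurable (G k) by rewrite /G; case: ifP => // _; exact: measurable_cube.
have EF : [set x | l%:E < truncated_HL_maximal t f x] `<=` \bigcup_k F k.
  move=> x /EV[k Vk xk]; have [j [Dj [z [zk zj]] rkj]] := maxD k Vk.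
  exists j => //; rewrite /F mem_set// => i.
  have := xk i; have := zk i; have := zj i.
  rewrite !ltr_distlC => /andP[a1 a2] /andP[b1 b2] /andP[c1 c2].
  by apply/andP; split; lra.
have mE : measurable [set x | l%:E < truncated_HL_maximal t f x].
  rewrite -[X in measurable X]setTI.
  by apply: emeasurable_fun_o_infty; [exact: measurableT|]; exact: measurable_truncated_HL_maximal.
have sub : mu [set x | l%:E < truncated_HL_maximal t f x] <=
    \sum_(0 <= k <oo) mu (F k).
  exact: (measure_sigma_subadditive mu mF mE EF).
apply: (le_trans sub).
apply: (@le_trans _ _ (\sum_(0 <= k <oo)
    ((10 * n%:R) ^+ n / l)%:E * \int[mu]_(y in G k) `|f y|%:E)).
  apply: lee_nneseries => [k _ _|k _]; first exact: measure_ge0.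
  rewrite /F /G; case: ifPn => [/set_mem Dk|_]; last first.
    by rewrite measure0 integral_set0 mule0.
  have [/andP[rk0 _] rkV] := DV _ Dk.
  rewrite lebesgue_Rn_cube; last by lra.
  rewrite -mulrnAr exprMn EFinM -(lebesgue_Rn_cube (ctr k)); last by lra.
  rewrite (_ : 10 * n%:R = 5 * (2 * n%:R))%R; last by ring.
  rewrite (exprMn _ 5%R) -mulrA EFinM -muleA lee_pmul2l ?lte_fin ?exprn_gt0//.
rewrite nneseriesZl; last by move=> k _; exact: integral_ge0.
apply: lee_wpmul2l.
  by rewrite lee_fin divr_ge0 ?exprn_ge0 ?mulr_ge0// ltW.
rewrite -ge0_integral_bigcup//.
- apply: ge0_subset_integral => //; exact: bigcup_measurable.
- apply/trivIsetP => i j _ _ ij; rewrite /G; case: ifPn => // [/set_mem Di|]; last by rewrite set0I.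
  by case: ifPn => [/set_mem Dj|]; rewrite ?setI0//; move/trivIsetP: tD; apply.
Qed.

End weak_type.

(** * The layer-cake formula and the strong inequality *)

Section layer_cake.
Context {R : realType}.
Local Notation leb := (@lebesgue_measure R).

Lemma continuous_powR (s t : R) : (0 < t)%R -> {for t, continuous (@powR R ^~ s)}.
Proof.
move=> t0; apply: differentiable_continuous; apply/derivable1_diffP.
by apply: derivable_powR; rewrite in_itv/= t0.
Qed.

Lemma measurable_powRM (s r : R) D :
  measurable_fun D (fun t : R => (s * t `^ r)%:E).
Proof.
apply: measurable_funTS; apply/measurable_EFinP.
by apply: measurable_funM => //; exact: measurable_powR.
Qed.

Lemma integral_powR_cc (s a b : R) : (0 < a)%R -> (a < b)%R ->
  \int[leb]_(t in `[a, b]) (s * t `^ (s - 1))%:E = (b `^ s - a `^ s)%:E.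
Proof.
move=> a0 ab; have b0 := lt_trans a0 ab.
rewrite EFinB; apply: (@continuous_FTC2 _ _ (@powR R ^~ s)) => //.
- apply: continuous_in_subspaceT => t; rewrite inE/= in_itv/= => /andP[at_ _].
  apply: cvgM; first exact: cvg_cst.
  exact/continuous_powR/(lt_le_trans a0).
- split.
  + move=> t; rewrite in_itv/= => /andP[at_ _]; apply: derivable_powR.
    by rewrite in_itv/= (lt_trans a0).
  + exact/cvg_at_right_filter/continuous_powR.
  + exact/cvg_at_left_filter/continuous_powR.
- move=> t; rewrite in_itv/= => /andP[at_ _]; apply: powR_derive1.
  by rewrite in_itv/= (lt_trans a0).
Qed.

(** The integrand may blow up at 0, so the fundamental theorem of calculus is applied on closed
    intervals away from 0, followed by monotone convergence. *)
Lemma integral_powR (s b : R) : (0 < s)%R -> (0 <= b)%R ->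
  \int[leb]_(t in `]0%R, b[) (s * t `^ (s - 1))%:E = (b `^ s)%:E.
Proof.
move=> s0; rewrite le_eqVlt => /predU1P[<-|b0].
  by rewrite set_itvoo0 integral_set0 powR0// gt_eqF.
rewrite integral_itv_bndo_bndc; last exact: measurable_powRM.
(* With [k.+2] the left end is strictly below [b] already for [k = 0], as the formula on closed
   intervals requires. *)
pose F k := `[(b / k.+2%:R)%R, b]%classic.
have FE : \bigcup_k F k = `]0%R, b]%classic.
  apply/seteqP; split => t; rewrite /F /= !in_itv/=.
    by move=> [k _] /=; rewrite in_itv/= => /andP[bt ->]; rewrite (lt_le_trans _ bt)// divr_gt0.
  move=> /andP[t0 tb].
  have tb0 : (0 < t / b)%R by rewrite divr_gt0.
  have [k _ /(_ k.+1 (leqnSn _)) /=] := near_infty_natSinv_lt (PosNum tb0).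
  move=> kt; exists k => //=; rewrite in_itv/= tb andbT.
  by move/ltW: kt; rewrite ler_pdivlMr// mulrC.
have : \int[leb]_(t in F k) (s * t `^ (s - 1))%:E @[k --> \oo] -->
       \int[leb]_(t in \bigcup_k F k) (s * t `^ (s - 1))%:E.
  apply: ge0_nondecreasing_set_cvg_integral => //.
  - apply/nondecreasing_seqP => k; apply/subsetPset => t; rewrite /F /= !in_itv/=.
    move=> /andP[+ ->]; rewrite andbT; apply: le_trans.
    by rewrite ler_pM2l// lef_pV2 ?posrE// ler_nat.
  - by move=> k; exact: measurable_itv.
  - by move=> k; exact: measurable_powRM.
  - by move=> k t _; rewrite lee_fin mulr_ge0 ?powR_ge0// ltW.
rewrite FE => /cvg_lim <- //; apply/cvg_lim => //.
rewrite [X in X @ \oo --> _](_ : _ = fun k => (b `^ s - (b / k.+2%:R) `^ s)%:E); last first.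
  apply/funext => k; rewrite /F integral_powR_cc// ?divr_gt0//.
  by rewrite ltr_pdivrMr// ltr_pMr// ltr1n.
apply: cvg_EFin; first exact: nearW.
rewrite -[X in _ --> X]subr0; apply: cvgB; first exact: cvg_cst.
have /cvg_at_rightP := powR_cvg0 s0; apply; split.
  by move=> k; rewrite divr_gt0.
rewrite -[X in _ --> X](mulr0 b); apply: cvgM; first exact: cvg_cst.
by rewrite (cvg_shiftS (fun k => k.+1%:R^-1 : R)%R); exact: cvg_harmonic.
Qed.

(* For [w = 1] this is the layer-cake formula; the weight accommodates the
   measure [|f| dm] in the proof of the maximal inequality. *)
Lemma weighted_layer_cake d (T : measurableType d)
    (m : {sigma_finite_measure set T -> \bar R}) (w : T -> R) (g : T -> \bar R)
    (s : R) : (0 < s)%R ->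
  measurable_fun setT w -> (forall x, 0 <= w x)%R ->
  measurable_fun setT g -> (forall x, 0 <= g x) ->
  \int[m]_x ((w x)%:E * g x `^ s) =
  \int[leb]_(t in `]0%R, +oo[) ((s * t `^ (s - 1))%:E *
      \int[m]_(x in [set x | t%:E < g x]) (w x)%:E).
Proof.
move=> s0 mw w0 mg g0.
have phi0 t : 0 <= (s * t `^ (s - 1))%:E.
  by rewrite lee_fin mulr_ge0 ?powR_ge0// ltW.
have mt x (D : set R) : measurable D -> measurable (D `&` [set t | t%:E < g x]).
  by move=> mD; apply: measurable_lte => //; exact: measurable_EFin.
have mgt t : measurable [set x | t%:E < g x].
  by rewrite -[X in measurable X]setTI; exact: emeasurable_fun_o_infty.
pose S := [set z : T * R | (0 < z.2)%R /\ z.2%:E < g z.1].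
have mS : measurable S.
  rewrite (_ : S = (setT `*` `]0%R, +oo[%classic) `&` [set z | z.2%:E < g z.1]); last first.
    by apply/seteqP; split => z; rewrite /S /= in_itv/= andbT; [move=> [? ?]|move=> [[_ ?] ?]].
  apply: measurable_lte.
  - by apply: measurableX.
  - by apply: measurable_funTS; apply/measurable_EFinP; exact: measurable_snd.
  - by apply: measurable_funTS; apply: measurableT_comp => //; exact: measurable_fst.
pose G := (fun z : T * R => (w z.1)%:E * (s * z.2 `^ (s - 1))%:E) \_ S.
have mG : measurable_fun setT G.
  apply/(measurable_restrictT _ mS); apply: measurable_funTS.
  apply: emeasurable_funM.
    by apply/measurable_EFinP; apply: measurableT_comp => //; exact: measurable_fst.
  apply: (measurableT_comp (@measurable_powRM s (s - 1) setT)).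
  exact: measurable_snd.
have G0 z : 0 <= G z.
  by apply: erestrict_ge0 => x _; apply: mule_ge0; rewrite ?phi0 ?lee_fin.
have GE x t : G (x, t) = if (0 < t)%R && (t%:E < g x) then (w x)%:E * (s * t `^ (s - 1))%:E else 0.
  by rewrite /G patchE; congr (if _ then _ else _); apply/idP/idP; rewrite inE /S /= => /andP.
(* [G] lives on the region under the graph of [g]. Integrating in [t] first gives [w x] times the
   integral of [s t^(s-1)] up to [g x]; Tonelli then exchanges the order. *)
transitivity (\int[m]_x \int[leb]_t G (x, t)).
  apply: eq_integral => x _.
  transitivity ((w x)%:E * \int[leb]_(t in `]0%R, +oo[ `&` [set t | t%:E < g x]) (s * t `^ (s - 1))%:E).
    congr (_ * _).
    case gx : (g x) => [c| |].
    - rewrite poweR_EFin -integral_powR//; last by rewrite -lee_fin -gx.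
      congr integral; apply/seteqP; split => t; rewrite /= !in_itv/= andbT lte_fin.
        by move=> /andP[].
      by move=> [-> ->].
    (* At an infinite value of [g] the integral over the half-line exceeds every [A], being at least
       the one up to [A^(1/s)]. *)
    - rewrite poweRyr ?gt_eqF//; apply/esym/eqyP => A A0.
      have b0 : (0 <= A `^ s^-1)%R by exact: powR_ge0.
      have AE : ((A `^ s^-1) `^ s = A)%R by rewrite -powRrM mulVf ?gt_eqF// powRr1// ltW.
      rewrite -AE -integral_powR//.
      apply: ge0_subset_integral.
      + exact: measurable_itv.
      + by have := mt x _ (@measurable_itv R `]0%R, +oo[); rewrite gx.
      + exact: measurable_powRM.
      + by move=> t _; exact: phi0.
      + by move=> t; rewrite /= !in_itv/= andbT ltry => /andP[].
    - by have := g0 x; rewrite gx.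
  rewrite -ge0_integralZl; last 4 first.
    - exact: (mt x _ (@measurable_itv R `]0%R, +oo[)).
    - exact: measurable_powRM.
    - by move=> t _; exact: phi0.
    - by rewrite lee_fin.
  rewrite integral_mkcond; apply: eq_integral => t _.
  rewrite GE patchE; congr (if _ then _ else _).
  by apply/idP/idP; rewrite inE /= in_itv/= andbT => /andP.
have FT := @fubini_tonelli _ _ _ _ _ m (@lebesgue_measure R) G mG G0.
etransitivity; first exact: FT.
rewrite [RHS]integral_mkcond; apply: eq_integral => t _.
rewrite patchE; case: ifPn; rewrite ?notin_setE ?inE/= in_itv/= andbT => t0.
  rewrite -ge0_integralZl; last 4 first.
  - exact: mgt.
  - by apply: measurable_funTS; apply/measurable_EFinP.
  - by move=> x _; rewrite lee_fin.
  - exact: phi0.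
  rewrite [RHS]integral_mkcond; apply: eq_integral => x _.
  rewrite GE patchE t0 muleC; congr (if _ then _ else _).
  by apply/idP/idP; rewrite inE.
by apply: integral0_eq => x _; rewrite GE (negbTE (introN idP t0)).
Qed.

Lemma measurable_layer d (T : measurableType d)
    (m : {sigma_finite_measure set T -> \bar R}) (w : T -> R) (g : T -> \bar R) :
  measurable_fun setT w -> (forall x, 0 <= w x)%R -> measurable_fun setT g ->
  measurable_fun setT (fun t : R => \int[m]_(x in [set x | t%:E < g x]) (w x)%:E).
Proof.
move=> mw w0 mg.
pose S := [set z : T * R | z.2%:E < g z.1].
have mS : measurable S.
  rewrite -[X in measurable X]setTI; apply: measurable_lte.
  - exact: measurableT.
  - by apply/measurable_EFinP; exact: measurable_snd.
  - by apply: measurableT_comp => //; exact: measurable_fst.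
pose G := (fun z : T * R => (w z.1)%:E) \_ S.
have mG : measurable_fun setT G.
  apply/(measurable_restrictT _ mS); apply: measurable_funTS.
  by apply/measurable_EFinP; apply: measurableT_comp => //; exact: measurable_fst.
have G0 z : 0 <= G z by apply: erestrict_ge0 => x _; rewrite lee_fin.
have := @measurable_fun_fubini_tonelli_G _ _ _ _ _ m G mG G0.
congr measurable_fun; apply/funext => t.
rewrite /fubini_G [RHS]integral_mkcond; apply: eq_integral => x _.
by rewrite /G !patchE; congr (if _ then _ else _); apply/idP/idP; rewrite !inE.
Qed.

End layer_cake.

(** * The strong (p,p) inequality *)

Section strong_type.
Context {R : realType} (n : nat).
Hypothesis n_gt0 : (0 < n)%N.
Local Notation mu := (@lebesgue_Rn R n).

Lemma truncated_HL_maximal_ge0 (t : R) (f : Rn R n -> R) x : (0 < t)%R ->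
  0 <= truncated_HL_maximal t f x.
Proof.
move=> t0; apply: (@le_trans _ _ ((mu (euclidean_ball x t))^-1 *
   \int[mu]_(y in euclidean_ball x t) `|f y|%:E)).
  apply: mule_ge0; first by rewrite inve_ge0 measure_ge0.
  by apply: integral_ge0.
by apply: ereal_sup_ubound; exists t => //=; rewrite in_itv/= t0 lexx.
Qed.

Lemma measurable_truncation (l : R) (f : Rn R n -> R) : measurable_fun setT f ->
  measurable_fun setT (fun y => if (l < 2 * `|f y|)%R then f y else 0%R).
Proof.
move=> mf; apply: (@measurable_fun_ifT _ _ _ _ f (cst 0%R)
    (fun y => l < 2 * `|f y|)%R); last exact: measurable_cst.
  apply: measurable_fun_ltr; first exact: measurable_cst.
  by apply: measurable_funM; [exact: measurable_cst|exact: measurableT_comp].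
exact: mf.
Qed.

(** Dropping the values with [2 |f| <= l] changes the average of [|f|] over any ball by at most
    [l / 2]. *)
Lemma HL_maximal_truncation (t l : R) (f : Rn R n -> R) x : measurable_fun setT f ->
  (0 < l)%R -> l%:E < truncated_HL_maximal t f x ->
  (l / 2)%:E < truncated_HL_maximal t (fun y => if (l < 2 * `|f y|)%R then f y else 0%R) x.
Proof.
move=> mf l0 /(gt_truncated_HL_maximal n_gt0)[r /andP[r0 rt] lr].
apply/(gt_truncated_HL_maximal n_gt0); exists r; first by rewrite r0.
pose h y := if (l < 2 * `|f y|)%R then f y else 0%R.
suff : mu (euclidean_ball x r) * (l / 2)%:E <
  \int[mu]_(y in euclidean_ball x r) `|h y|%:E by [].
have mh : measurable_fun setT h by exact: measurable_truncation.
have mB := measurable_euclidean_ball x r.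
have v0 := lebesgue_Rn_euclidean_ball_gt0 n_gt0 x r0.
have vf := lebesgue_Rn_euclidean_ball_fin x r.
have mhE A : measurable_fun A (fun y => `|h y|%:E).
  by apply: measurable_funTS; apply/measurable_EFinP; exact: measurableT_comp.
have mfE A : measurable_fun A (fun y => `|f y|%:E).
  by apply: measurable_funTS; apply/measurable_EFinP; exact: measurableT_comp.
have fh : \int[mu]_(y in euclidean_ball x r) `|f y|%:E <=
    \int[mu]_(y in euclidean_ball x r) `|h y|%:E + mu (euclidean_ball x r) * (l / 2)%:E.
  rewrite [X in _ + X]muleC -integral_cst// -ge0_integralD//; last first.
    by move=> y _; rewrite lee_fin divr_ge0// ltW.
  apply: ge0_le_integral.
  - exact: mB.
  - by move=> y _; rewrite lee_fin.
  - exact: mfE.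
  - by apply: emeasurable_funD; [exact: mhE|exact: measurable_cst].
  move=> y _; rewrite -EFinD lee_fin /h; case: ifPn => [_|].
    by rewrite lerDl divr_ge0// ltW.
  by rewrite -leNgt normr0 add0r ler_pdivlMr// mulrC.
have : mu (euclidean_ball x r) * l%:E <
    \int[mu]_(y in euclidean_ball x r) `|h y|%:E + mu (euclidean_ball x r) * (l / 2)%:E.
  exact: lt_le_trans fh.
move: vf v0; case: (mu (euclidean_ball x r)) => // v _; rewrite lte_fin => v0.
have {1}-> : l = (l / 2 + l / 2)%R by lra.
by rewrite -!EFinM mulrDr EFinD lteD2rE.
Qed.

(** The weak inequality at level [l / 2] for the truncated function, whence the factor 2.
    Restricting the integral to [l < 2 |f|] is the gain that lets the integral over levels
    converge. *)
Lemma HL_maximal_distribution (t l : R) (f : Rn R n -> R) :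
  measurable_fun setT f -> (t <= 1)%R -> (0 < l)%R ->
  mu [set x | l%:E < truncated_HL_maximal t f x] <=
  (2 * (10 * n%:R) ^+ n / l)%:E *
     \int[mu]_(x in [set x | l%:E < (2 * `|f x|)%:E]) `|f x|%:E.
Proof.
move=> mf t1 l0; set h := fun y => if (l < 2 * `|f y|)%R then f y else 0%R.
have mh : measurable_fun setT h by exact: measurable_truncation.
have l20 : (0 < l / 2)%R by rewrite divr_gt0.
have mM (g : Rn R n -> R) (k : R) : measurable_fun setT g ->
    measurable [set x | k%:E < truncated_HL_maximal t g x].
  move=> mg; rewrite -[X in measurable X]setTI.
  apply: emeasurable_fun_o_infty; first exact: measurableT.
  exact: (measurable_truncated_HL_maximal n_gt0).
apply: (@le_trans _ _ (mu [set x | (l / 2)%:E < truncated_HL_maximal t h x])).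
  apply: le_measure; rewrite ?inE; [exact: mM|exact: mM|].
  by move=> x /=; exact: HL_maximal_truncation.
apply: (le_trans (HL_maximal_weak_type n_gt0 mh t1 l20)).
rewrite (_ : (10 * n%:R) ^+ n / (l / 2) = 2 * (10 * n%:R) ^+ n / l)%R; last first.
  by rewrite invf_div mulrA [(_ * 2)%R]mulrC.
rewrite le_eqVlt; apply/orP; left; apply/eqP; congr (_ * _).
rewrite [RHS]integral_mkcond; apply: eq_integral => x _.
rewrite patchE /h; case: ifPn => [lf|lf]; first by rewrite mem_set.
by rewrite memNset/= ?normr0// lte_fin; apply/negP.
Qed.

(** The layer-cake formula is used twice: with weight 1 and exponent [p] for M_t f, then backwards
    with weight [|f|] and exponent [p - 1] for [2 |f|]. The distribution bound links the two, and
    [K] collects its constant and the factor [p / (p - 1)] turning [p l^(p-2)] into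
    [(p - 1) l^(p-2)]; recombining [|f| (2 |f|)^(p-1)] produces [2^(p-1)]. *)
Lemma HL_maximal_strong_type (p : R) : (1 < p)%R ->
  exists2 C : R, (0 < C)%R & forall (t : R) (f : Rn R n -> R),
    measurable_fun setT f -> (0 < t <= 1)%R ->
    \int[mu]_x (truncated_HL_maximal t f x `^ p) <=
      C%:E * \int[mu]_x (`|f x| `^ p)%:E.
Proof.
move=> p1; have p0 : (0 < p)%R by lra.
have q0 : (0 < p - 1)%R by lra.
have W0 : (0 < (10 * n%:R) ^+ n :> R)%R by rewrite exprn_gt0// mulr_gt0// ltr0n.
set W := ((10 * n%:R) ^+ n)%R in W0.
pose K : R := (2 * W * p / (p - 1))%R.
have K0 : (0 < K)%R by rewrite divr_gt0// !mulr_gt0.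
exists (K * 2 `^ (p - 1))%R; first by rewrite mulr_gt0// powR_gt0.
move=> t f mf /andP[t0 t1].
have mM := measurable_truncated_HL_maximal n_gt0 t mf.
have M0 x := truncated_HL_maximal_ge0 f x t0.
have mf2 : measurable_fun setT (fun x => (2 * `|f x|)%:E).
  apply/measurable_EFinP; apply: measurable_funM; first exact: measurable_cst.
  exact: measurableT_comp.
have mnf : measurable_fun setT (fun x => `|f x|%R) by exact: measurableT_comp.
have mE k : measurable [set x | k%:E < truncated_HL_maximal t f x].
  rewrite -[X in measurable X]setTI.
  by apply: emeasurable_fun_o_infty; first exact: measurableT.
under eq_integral do rewrite -[_ `^ _]mul1e.
have -> := @weighted_layer_cake _ _ _ mu (cst 1%R) _ _ p0 (measurable_cst _)
  (fun=> ler01) mM M0.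
apply: (@le_trans _ _ (\int[lebesgue_measure]_(l in `]0%R, +oo[)
   (K%:E * (((p - 1) * l `^ (p - 1 - 1))%:E *
     \int[mu]_(x in [set x | l%:E < (2 * `|f x|)%:E]) `|f x|%:E)))).
  apply: ge0_le_integral.
  - exact: measurable_itv.
  - move=> l _; apply: mule_ge0.
      by rewrite lee_fin mulr_ge0 ?powR_ge0// ltW.
    by apply: integral_ge0 => x _; rewrite lee_fin.
  - apply: emeasurable_funM; first exact: measurable_powRM.
    apply: measurable_funTS.
    exact: (@measurable_layer _ _ _ mu (cst 1%R) _ (measurable_cst _) (fun=> ler01) mM).
  - apply: emeasurable_funM; first exact: measurable_cst.
    apply: emeasurable_funM; first exact: measurable_powRM.
    apply: measurable_funTS.
    exact: (@measurable_layer _ _ _ mu _ _ mnf (fun=> normr_ge0 _) mf2).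
  - move=> l; rewrite /= in_itv/= andbT => l0.
    rewrite integral_cst; last exact: mE.
    rewrite mul1e.
    apply: le_trans.
      apply: lee_wpmul2l; last exact: (HL_maximal_distribution mf t1 l0).
      by rewrite lee_fin mulr_ge0 ?powR_ge0// ltW.
    rewrite !muleA -!EFinM.
    rewrite (_ : (p * _ * _ = K * ((p - 1) * l `^ (p - 1 - 1)))%R)//.
    have -> : (l `^ (p - 1) = l * l `^ (p - 1 - 1))%R.
      rewrite -{2}[(l : R)]powRr1 ?ltW// -powRD; first by congr (powR _ _); lra.
      by rewrite (gt_eqF l0) implybT.
    rewrite /K -/W; field; rewrite ?gt_eqF//.
rewrite ge0_integralZl; last 4 first.
- exact: measurable_itv.
- apply: emeasurable_funM; first exact: measurable_powRM.
  apply: measurable_funTS.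
  exact: (@measurable_layer _ _ _ mu _ _ mnf (fun=> normr_ge0 _) mf2).
- move=> l _; apply: mule_ge0.
    by rewrite lee_fin mulr_ge0 ?powR_ge0// ltW.
  by apply: integral_ge0 => x _; rewrite lee_fin.
- by rewrite lee_fin ltW.
have f20 x : 0 <= (2 * `|f x|)%:E by rewrite lee_fin mulr_ge0.
have <- := @weighted_layer_cake _ _ _ mu _ _ _ q0 mnf (fun=> normr_ge0 _) mf2 f20.
rewrite (EFinM K) -muleA le_eqVlt; apply/orP; left; apply/eqP; congr (_ * _).
rewrite -ge0_integralZl; last 4 first.
- exact: measurableT.
- by apply/measurable_EFinP; exact: (measurableT_comp (measurable_powR p) mnf).
- by move=> x _; rewrite lee_fin powR_ge0.
- by rewrite lee_fin powR_ge0.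
apply: eq_integral => x _.
rewrite poweR_EFin -!EFinM powRM// mulrCA; congr (_ * _)%:E.
have [->|fx0] := eqVneq `|f x|%R 0%R; first by rewrite mul0r powR0// gt_eqF.
rewrite -{1}[`|f x|%R]powRr1// -powRD; first by congr (powR _ _); lra.
by rewrite fx0 implybT.
Qed.

End strong_type.

(** * Lebesgue points *)

Section lebesgue_points.
Context {R : realType} (n : nat).
Hypothesis n_gt0 : (0 < n)%N.
Local Notation mu := (@lebesgue_Rn R n).
Implicit Types (f g : Rn R n -> R) (x : Rn R n).

(** The usual condition that the averages of [|f - f x|] tend to 0, multiplied out by the measure of
    the ball so that no extended-real quotient appears. *)
Definition Rn_lebesgue_pt f x := forall e : R, (0 < e)%R ->
  exists2 d : R, (0 < d)%R & forall r, (0 < r <= d)%R ->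
    \int[mu]_(y in euclidean_ball x r) `|f y - f x|%:E <=
      e%:E * mu (euclidean_ball x r).

Lemma euclidean_ball_center x (r : R) : (0 < r)%R -> euclidean_ball x r x.
Proof.
by move=> r0; rewrite /euclidean_ball /= big1 ?sqrtr0// => i _; rewrite subrr expr0n.
Qed.

Lemma measurable_abse_sub f (c : R) A : measurable_fun setT f ->
  measurable_fun A (fun y => `|f y - c|%:E).
Proof.
move=> mf; apply: measurable_funTS; apply/measurable_EFinP.
apply: measurableT_comp; first exact: normr_measurable.
by apply: measurable_funB; [exact: mf|exact: measurable_cst].
Qed.

Lemma Rn_lebesgue_pt_local f g x :
  (exists2 d : R, (0 < d)%R & forall y, euclidean_ball x d y -> f y = g y) ->
  Rn_lebesgue_pt g x -> Rn_lebesgue_pt f x.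
Proof.
move=> [d d0 fg] gx e e0; have [d' d'0 H] := gx e e0.
exists (Num.min d d'); first by rewrite lt_min d0.
move=> r; rewrite le_min => /andP[r0 /andP[rd rd']].
have := H r; rewrite r0 rd' => /(_ isT); apply: le_trans.
rewrite le_eqVlt; apply/orP; left; apply/eqP; apply: eq_integral => y /set_mem yx.
rewrite fg ?(fg x)//; first exact: euclidean_ball_center.
exact: euclidean_ball_le yx.
Qed.

Lemma Rn_lebesgue_pt_cst (c : R) x : Rn_lebesgue_pt (cst c) x.
Proof.
move=> e e0; exists 1%R => // r _.
rewrite integral0_eq; last by move=> y _; rewrite subrr normr0.
by rewrite mule_ge0// lee_fin ltW.
Qed.

Lemma Rn_lebesgue_ptZ f (k : R) x : measurable_fun setT f ->
  Rn_lebesgue_pt f x -> Rn_lebesgue_pt (fun y => k * f y)%R x.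
Proof.
move=> mf fx e e0.
have k0 : (0 < `|k| + 1)%R by rewrite ltr_wpDl.
have [d d0 H] := fx (e / (`|k| + 1))%R (divr_gt0 e0 k0).
exists d => // r rd.
apply: (@le_trans _ _ ((`|k|)%:E * \int[mu]_(y in euclidean_ball x r) `|f y - f x|%:E)).
  rewrite -ge0_integralZl; last 4 first.
  - exact: measurable_euclidean_ball.
  - exact: measurable_abse_sub.
  - by move=> y _; rewrite lee_fin.
  - by rewrite lee_fin.
  rewrite le_eqVlt; apply/orP; left; apply/eqP; apply: eq_integral => y _.
  by rewrite -mulrBr normrM.
apply: (@le_trans _ _ (`|k|%:E * ((e / (`|k| + 1))%:E * mu (euclidean_ball x r)))).
  by apply: lee_wpmul2l; [rewrite lee_fin|exact: H].
rewrite muleA -EFinM; apply: lee_wpmul2r; first exact: measure_ge0.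
rewrite lee_fin mulrCA ler_piMr//; first exact: ltW.
by rewrite ler_pdivrMr// mul1r lerDl.
Qed.

Lemma Rn_lebesgue_ptD f g x : measurable_fun setT f -> measurable_fun setT g ->
  Rn_lebesgue_pt f x -> Rn_lebesgue_pt g x -> Rn_lebesgue_pt (f \+ g)%R x.
Proof.
move=> mf mg fx gx e e0.
have e20 : (0 < e / 2)%R by rewrite divr_gt0.
have [d d0 H] := fx _ e20; have [d' d'0 H'] := gx _ e20.
exists (Num.min d d'); first by rewrite lt_min d0.
move=> r; rewrite le_min => /andP[r0 /andP[rd rd']].
have mB := measurable_euclidean_ball x r.
apply: (@le_trans _ _ (\int[mu]_(y in euclidean_ball x r)
   (`|f y - f x|%:E + `|g y - g x|%:E))).
  apply: ge0_le_integral.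
  - exact: mB.
  - by move=> y _; rewrite lee_fin.
  - by apply: (measurable_abse_sub (f := f \+ g)%R); exact: measurable_funD.
  - by apply: emeasurable_funD; exact: measurable_abse_sub.
  - move=> y _; rewrite -EFinD lee_fin /= (_ : _ - _ = (f y - f x) + (g y - g x))%R.
      exact: ler_normD.
    by ring.
rewrite ge0_integralD; last 5 first.
- exact: mB.
- by move=> y _; rewrite lee_fin.
- exact: measurable_abse_sub.
- by move=> y _; rewrite lee_fin.
- exact: measurable_abse_sub.
have e20' := ltW e20.
rewrite [e]splitr EFinD ge0_muleDl ?lee_fin//.
by apply: leeD; [apply: H; rewrite r0|apply: H'; rewrite r0].
Qed.

Lemma ae_Rn_lebesgue_pt_sum (I : Type) (s : seq I) (F : I -> Rn R n -> R) :
  (forall i, measurable_fun setT (F i)) ->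
  (forall i, {ae mu, forall x, Rn_lebesgue_pt (F i) x}) ->
  {ae mu, forall x, Rn_lebesgue_pt (fun y => \sum_(i <- s) F i y)%R x}.
Proof.
move=> mF aeF; elim: s => [|i s ih].
  apply: aeW => x; rewrite (_ : (fun _ => _) = cst 0%R).
    exact: Rn_lebesgue_pt_cst.
  by apply/funext => y; rewrite big_nil.
rewrite (_ : (fun _ => _) = (F i \+ (fun y => \sum_(i <- s) F i y))%R); last first.
  by apply/funext => y; rewrite big_cons.
apply: filterS2 (aeF i) ih => x Fix sx.
by apply: Rn_lebesgue_ptD; [exact: mF|exact: measurable_sum|exact: Fix|exact: sx].
Qed.

(** [|f y - f x|] is at most [|f - g|] at [y], plus [|g y - g x|], plus [|f - g|] at [x]. Their
    averages are each at most [e], by the maximal function, the Lebesgue point of [g] and the last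
    hypothesis; the radius is capped at 1 to fit M_1. *)
Lemma Rn_lebesgue_pt_approx f g x (e : R) :
  measurable_fun setT f -> measurable_fun setT g -> (0 < e)%R ->
  Rn_lebesgue_pt g x -> truncated_HL_maximal 1 (f \- g)%R x <= e%:E ->
  (`|f x - g x| <= e)%R ->
  exists2 d : R, (0 < d)%R & forall r, (0 < r <= d)%R ->
    \int[mu]_(y in euclidean_ball x r) `|f y - f x|%:E <=
      (3 * e)%:E * mu (euclidean_ball x r).
Proof.
move=> mf mg e0 gx Me fge.
have [d d0 H] := gx e e0.
exists (Num.min d 1%R); first by rewrite lt_min d0 ltr01.
move=> r; rewrite le_min => /andP[r0 /andP[rd r1]].
have mB := measurable_euclidean_ball x r.
have mfg : measurable_fun setT (f \- g)%R by exact: measurable_funB.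
have mfgE : measurable_fun (euclidean_ball x r) (fun y => `|(f \- g)%R y|%:E).
  have := @measurable_abse_sub _ 0%R (euclidean_ball x r) mfg.
  by under eq_fun do rewrite subr0.
have Mr : \int[mu]_(y in euclidean_ball x r) `|(f \- g)%R y|%:E <=
    e%:E * mu (euclidean_ball x r).
  rewrite muleC leNgt; apply/negP => h.
  have : e%:E < truncated_HL_maximal 1 (f \- g)%R x.
    by apply/(gt_truncated_HL_maximal n_gt0); exists r => //; rewrite r0.
  by rewrite ltNge Me.
have Hr := H r; rewrite r0 rd in Hr; have {}Hr := Hr isT.
apply: (@le_trans _ _ (\int[mu]_(y in euclidean_ball x r)
   (`|(f \- g)%R y|%:E + (`|g y - g x|%:E + e%:E)))).
  apply: ge0_le_integral.
  - exact: mB.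
  - by move=> y _; rewrite lee_fin.
  - exact: measurable_abse_sub.
  - apply: emeasurable_funD; first exact: mfgE.
    by apply: emeasurable_funD; [exact: measurable_abse_sub|exact: measurable_cst].
  - move=> y _; rewrite -!EFinD lee_fin /=.
    rewrite (_ : f y - f x = (f y - g y) + ((g y - g x) - (f x - g x)))%R; last by ring.
    rewrite (le_trans (ler_normD _ _))// lerD2l (le_trans (ler_normB _ _))//.
    by rewrite lerD2l.
rewrite ge0_integralD; last 5 first.
- exact: mB.
- by move=> y _; rewrite lee_fin.
- exact: mfgE.
- by move=> y _; rewrite -EFinD lee_fin addr_ge0// ltW.
- by apply: emeasurable_funD; [exact: measurable_abse_sub|exact: measurable_cst].
rewrite ge0_integralD; last 5 first.
- exact: mB.
- by move=> y _; rewrite lee_fin.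
- exact: measurable_abse_sub.
- by move=> y _; rewrite lee_fin ltW.
- exact: measurable_cst.
rewrite integral_cst; last exact: mB.
rewrite (_ : 3 * e = e + (e + e))%R; last by ring.
have e0' := ltW e0; have ee0 := addr_ge0 e0' e0'.
rewrite EFinD ge0_muleDl ?lee_fin// EFinD ge0_muleDl ?lee_fin//.
by apply: leeD => //; apply: leeD.
Qed.

(* Weak type (1,1): the functions almost every point of which is a Lebesgue
   point are closed for the L^1 distance. *)
Lemma ae_Rn_lebesgue_pt_closed f : measurable_fun setT f ->
  (forall e : R, (0 < e)%R -> exists g, [/\ measurable_fun setT g,
     {ae mu, forall x, Rn_lebesgue_pt g x} &
     \int[mu]_x `|f x - g x|%:E <= e%:E]) ->
  {ae mu, forall x, Rn_lebesgue_pt f x}.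
Proof.
move=> mf fapprox.
pose good e x := exists2 d : R, (0 < d)%R & forall r, (0 < r <= d)%R ->
    \int[mu]_(y in euclidean_ball x r) `|f y - f x|%:E <=
      (3 * e)%:E * mu (euclidean_ball x r).
have good_ae (e : R) : (0 < e)%R -> {ae mu, forall x, good e x}.
  move=> e0.
  (* The summand [(10 n)^n] comes from the weak inequality and 1 from Chebyshev's; with an
     approximation error [e / W / (k + 1)] the two exceptional sets together have measure at most
     [1 / (k + 1)]. *)
  pose W : R := ((10 * n%:R) ^+ n + 1)%R.
  have W0 : (0 < W)%R by rewrite ltr_wpDl// exprn_ge0// mulr_ge0.
  have eps_gt0 k : (0 < e / W / k.+1%:R)%R by rewrite !divr_gt0.
  have /choice[g_ gP] (k : nat) := fapprox _ (eps_gt0 k).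
  have mg k : measurable_fun setT (g_ k) by have [] := gP k.
  have mfg k : measurable_fun setT (f \- g_ k)%R by exact: measurable_funB.
  have /choice[Z ZP] k : exists Z : set (Rn R n),
      [/\ measurable Z, mu Z = 0 & ~` [set x | Rn_lebesgue_pt (g_ k) x] `<=` Z].
    by have [_ [Z [mZ Z0 HZ]] _] := gP k; exists Z.
  pose A k := [set x | e%:E < truncated_HL_maximal 1 (f \- g_ k)%R x].
  pose B k := [set x | e%:E < `|f x - g_ k x|%:E].
  have mA k : measurable (A k).
    rewrite -[X in measurable X]setTI.
    apply: emeasurable_fun_o_infty; first exact: measurableT.
    exact: (measurable_truncated_HL_maximal n_gt0).
  have mfgE k : measurable_fun setT (fun x => `|(f \- g_ k)%R x|%:E).
    have := @measurable_abse_sub _ 0%R setT (mfg k).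
    by under eq_fun do rewrite subr0.
  have mB k : measurable (B k).
    rewrite -[X in measurable X]setTI.
    by apply: emeasurable_fun_o_infty; [exact: measurableT|exact: mfgE].
  have mZ k : measurable (Z k) by have [] := ZP k.
  (* Every point outside [N] is good thanks to some [g_ k]. The [k]-th set has measure at most
     [1 / (k + 1)], so the intersection is null. *)
  pose N := \bigcap_k (Z k `|` (A k `|` B k)).
  exists N; split.
  - apply: bigcapT_measurable => k.
    by apply: measurableU; [exact: mZ|apply: measurableU; [exact: mA|exact: mB]].
  - apply/eqP; rewrite eq_le measure_ge0 andbT.
    apply/lee_addgt0Pr => c c0; rewrite add0e.
    have [k _ /(_ k (leqnn _)) /= kc] := near_infty_natSinv_lt (PosNum c0).
    have [_ _ fgk] := gP k.
    have Ak : mu (A k) <= ((10 * n%:R) ^+ n / e)%:E * (e / W / k.+1%:R)%:E.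
      apply: le_trans (HL_maximal_weak_type n_gt0 (mfg k) (lexx _) e0) _.
      apply: lee_wpmul2l; last exact: fgk.
      by rewrite lee_fin divr_ge0 ?exprn_ge0 ?mulr_ge0// ltW.
    have Bk : mu (B k) <= (e^-1)%:E * (e / W / k.+1%:R)%:E.
      rewrite lee_pdivlMl// (le_trans _ fgk)//.
      have := @le_integral_abse _ _ _ mu setT measurableT _ e (mfgE k) e0.
      move=> h; apply: le_trans (le_trans h _); last first.
        by rewrite le_eqVlt; apply/orP; left; apply/eqP; apply: eq_integral => x _; rewrite /= normr_id.
      apply: lee_wpmul2l; first by rewrite lee_fin ltW.
      apply: le_measure; rewrite ?inE; [exact: mB| |].
        apply: emeasurable_fun_c_infty; first exact: measurableT.
        by apply: measurableT_comp; [exact: abse_measurable|exact: mfgE].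
      by move=> x /= h'; split => //=; rewrite normr_id ltW.
    apply: (@le_trans _ _ (mu (Z k `|` (A k `|` B k)))).
      apply: le_measure; rewrite ?inE.
      + apply: bigcapT_measurable => j.
        by apply: measurableU; [exact: mZ|apply: measurableU; [exact: mA|exact: mB]].
      + by apply: measurableU; [exact: mZ|apply: measurableU; [exact: mA|exact: mB]].
      + by move=> x; exact.
    have U1 : mu (Z k `|` (A k `|` B k)) <= mu (Z k) + mu (A k `|` B k).
      exact: measureU2 (mZ k) (measurableU _ _ (mA k) (mB k)).
    have U2 : mu (A k `|` B k) <= mu (A k) + mu (B k).
      exact: measureU2 (mA k) (mB k).
    have [_ Z0 _] := ZP k.
    apply: (le_trans U1); rewrite Z0 add0e; apply: (le_trans U2).
    apply: (le_trans (leeD Ak Bk)); rewrite -!EFinM -EFinD lee_fin.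
    rewrite (_ : _ + _ = k.+1%:R^-1)%R; first exact: ltW.
    have aux (V c' k' : R) : c' != 0%R -> k' != 0%R -> (V + 1)%R != 0%R ->
        (V / c' * (c' / (V + 1) / k') + c'^-1 * (c' / (V + 1) / k') = k'^-1)%R.
      by move=> ? ? ?; field; apply/and3P; split.
    by apply: aux; rewrite gt_eqF.
  - move=> x /= ngx k _; have [_ _ ZkP] := ZP k.
    have [gkx|ngkx] := pselect (Rn_lebesgue_pt (g_ k) x); last by left; apply: ZkP.
    right; apply: contrapT => /not_orP[/negP nA /negP nB]; apply: ngx.
    apply: (Rn_lebesgue_pt_approx mf (mg k) e0 gkx).
      by rewrite leNgt.
    by rewrite -lee_fin leNgt.
(* Countably many tolerances, so that a single null set serves for all [e]. *)
have : {ae mu, forall x k, good (k.+1%:R^-1)%R x}.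
  by apply/ae_foralln => k; exact: good_ae.
apply: filterS => x gx e e0.
have e30 : (0 < e / 3)%R by rewrite divr_gt0.
have [k _ /(_ k (leqnn _)) /= kc] := near_infty_natSinv_lt (PosNum e30).
have [d d0 H] := gx k; exists d => // r rd; apply: (le_trans (H r rd)).
apply: lee_wpmul2r; first exact: measure_ge0.
by move: kc; rewrite ltr_pdivlMr// mulrC => /ltW; rewrite lee_fin.
Qed.

End lebesgue_points.

(** * Lebesgue points of indicators of Borel sets *)

Section ae_lebesgue_points.
Context {R : realType} (n : nat).
Hypothesis n_gt0 : (0 < n)%N.
Local Notation mu := (@lebesgue_Rn R n).
Implicit Types (f g : Rn R n -> R) (x : Rn R n) (E : set (n.-tuple R)).

(** That is, [x] is not on the boundary of [E]. *)
Definition locally_constant_at E x := exists2 d : R, (0 < d)%R &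
  forall y, euclidean_ball x d y -> E y <-> E x.

(* A pi-system generating the Borel sets, the indicators of which are trivially
   differentiable almost everywhere. *)
Definition ae_locally_constant E :=
  measurable E /\ {ae mu, forall x, locally_constant_at E x}.

Lemma ae_locally_constantT : ae_locally_constant setT.
Proof. by split; [exact: measurableT|apply: aeW => x; exists 1%R]. Qed.

Lemma ae_locally_constantI : setI_closed ae_locally_constant.
Proof.
move=> A B [mA aeA] [mB aeB]; split; first exact: measurableI.
apply: filterS2 aeA aeB => x [d d0 Ad] [d' d'0 Bd].
exists (Num.min d d'); first by rewrite lt_min d0.
move=> y yx; have [h1 h2] : euclidean_ball x d y /\ euclidean_ball x d' y.
  by split; apply: euclidean_ball_le yx; rewrite ge_min lexx ?orbT.
by split=> -[h3 h4]; split; [exact/(Ad y h1)|exact/(Bd y h2)|exact/(Ad y h1)|exact/(Bd y h2)].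
Qed.

(** One factor of the product has measure 0 and the others are infinite; the convention
    [0 * +oo = 0] applies. *)
Lemma lebesgue_Rn_hyperplane (i : 'I_n) (a : R) :
  mu [set x | tnth x i = a] = 0.
Proof.
pose A (j : 'I_n) : set R := if j == i then [set a] else setT.
have mA j : measurable (A j) by rewrite /A; case: ifP.
have -> : [set x : Rn R n | tnth x i = a] = [set x : n.-tuple R | forall j, A j (tnth x j)].
  apply/seteqP; split => x /= h; last by have := h i; rewrite /A eqxx.
  by move=> j; rewrite /A; case: eqP => // ->.
rewrite lebesgue_Rn_Borel; last exact: measurable_box.
by rewrite product_lebesgue_box// (bigD1 i)//= /A eqxx lebesgue_measure_set1 mul0e.
Qed.

(** The hypothesis says that membership in [A] depends only on the position relative to [a]. The
    boundary then lies in the hyperplane [x_i = a], and off it the ball of radius [|x_i - a|] stays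
    on one side. *)
Lemma ae_locally_constant_coord (i : 'I_n) (A : set R) (a : R) : measurable A ->
  (forall u v, (u < a)%R = (v < a)%R -> (a < u)%R = (a < v)%R -> A u -> A v) ->
  ae_locally_constant [set x | A (tnth x i)].
Proof.
move=> mA Aa; split.
  by rewrite -[X in measurable X]setTI; exact: (@measurable_tnth _ (measurableTypeR R)).
exists [set x | tnth x i = a]; split.
- have := measurable_fun_tnth_Rn i measurableT (@measurable_set1 R a).
  by rewrite setTI.
- exact: lebesgue_Rn_hyperplane.
- move=> x /= nx; apply: contrapT => xa; apply: nx.
  exists `|tnth x i - a|%R; first by rewrite normr_gt0 subr_eq0; apply/eqP.
  move=> y /euclidean_ball_sub_cube /(_ i) h.
  have [h1 h2] : ((tnth y i < a)%R = (tnth x i < a)%R) /\ ((a < tnth y i)%R = (a < tnth x i)%R).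
    move: h; have [xa'|xa'|//] := ltgtP (tnth x i) a.
      rewrite [X in (_ < X)%R]ltr0_norm ?subr_lt0// ltr_distlC => /andP[u v].
      by split; [apply/idP|apply/negbTE; rewrite -leNgt]; lra.
    rewrite [X in (_ < X)%R]gtr0_norm ?subr_gt0// ltr_distlC => /andP[u v].
    by split; [apply/negbTE; rewrite -leNgt|apply/idP]; lra.
  by split; apply: Aa.
Qed.

(** The class contains the half-spaces [x_i > a], which already make every coordinate measurable. *)
Lemma measurable_tuple_generated :
  @measurable _ (n.-tuple R) = <<s ae_locally_constant >>.
Proof.
apply/seteqP; split; last first.
  apply: smallest_sub; first exact: sigma_algebra_measurable.
  by move=> E [].
pose T := g_sigma_algebraType ae_locally_constant.
have mid : measurable_fun [set: T] (fun x : T => x : n.-tuple R).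
  apply/measurable_fun_tnthP => i.
  apply: (measurability _ (RGenOInfty.measurableE R)) => _ [_ [a ->] <-].
  rewrite setTI; apply: sub_sigma_algebra.
  apply: (@ae_locally_constant_coord i `]a, +oo[%classic a) => //.
  by move=> u v _ h /=; rewrite !in_itv/= !andbT h.
by move=> E mE; have := mid measurableT E mE; rewrite setTI.
Qed.

Let orig : Rn R n := [tuple 0%R | i < n].

(** A finite intersection of half-spaces, built by induction on a list of coordinates. *)
Lemma ae_locally_constant_cube (r : R) : ae_locally_constant (cube orig r).
Proof.
suff H (s : seq 'I_n) : ae_locally_constant
    [set x : n.-tuple R | forall i, i \in s -> (`|tnth x i| < r)%R].
  rewrite (_ : cube _ _ = [set x : n.-tuple R | forall i, i \in enum 'I_n ->
      (`|tnth x i| < r)%R]); first exact: H.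
  apply/seteqP; split => x /= h i.
    by move=> _; have := h i; rewrite tnth_mktuple sub0r normrN.
  by rewrite tnth_mktuple sub0r normrN; apply: h; rewrite mem_enum.
elim: s => [|i s ih].
  rewrite (_ : [set x | _] = setT); first exact: ae_locally_constantT.
  by apply/seteqP; split.
rewrite (_ : [set x | _] = ([set x : n.-tuple R | `]-oo, r[%classic (tnth x i)] `&`
    [set x | `](- r)%R, +oo[%classic (tnth x i)]) `&`
    [set x | forall j, j \in s -> (`|tnth x j| < r)%R]).
  apply: ae_locally_constantI => //; apply: ae_locally_constantI.
    apply: (@ae_locally_constant_coord i _ r); first exact: measurable_itv.
    by move=> u v h _; rewrite /= !in_itv/= h.
  apply: (@ae_locally_constant_coord i _ (- r)%R); first exact: measurable_itv.
  by move=> u v _ h; rewrite /= !in_itv/= !andbT h.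
apply/seteqP; split => x /=; rewrite !in_itv/= andbT.
  move=> h; split; last by move=> j js; apply: h; rewrite inE js orbT.
  by have := h i (mem_head _ _); rewrite ltr_norml => /andP[].
move=> [[h1 h2] h] j; rewrite inE => /predU1P[->|]; last exact: h.
by rewrite ltr_norml h1 h2.
Qed.

Lemma lebesgue_Rn_cube_lty (r : R) : mu (cube orig r) < +oo.
Proof.
apply: (@le_lt_trans _ _ (mu (cube orig `|r|%R))).
  apply: le_measure; rewrite ?inE; [exact: measurable_cube..|].
  by move=> x h i; apply: lt_le_trans (h i) (ler_norm _).
by rewrite lebesgue_Rn_cube// ltry.
Qed.

Lemma locally_constant_lebesgue_pt E x :
  locally_constant_at E x -> Rn_lebesgue_pt (\1_E : Rn R n -> R) x.
Proof.
move=> [d d0 Ed]; apply: (@Rn_lebesgue_pt_local _ _ _ (cst (\1_E x))); last first.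
  exact: Rn_lebesgue_pt_cst.
exists d => // y /Ed h; rewrite /= !indicE; congr (_%:R).
by apply: congr1; apply/idP/idP; rewrite !inE => /h.
Qed.

Lemma integral_indic_sub_le (A B S : set (Rn R n)) :
  measurable A -> measurable B -> measurable S ->
  (forall x, ~ S x -> A x <-> B x) ->
  \int[mu]_x `|(\1_A x - \1_B x : R)|%:E <= mu S.
Proof.
move=> mA mB mS AB.
rewrite (_ : mu S = \int[mu]_x (\1_S x)%:E); last first.
  by rewrite integral_indic ?setIT//; exact: measurableT.
apply: ge0_le_integral.
- exact: measurableT.
- by move=> x _; rewrite lee_fin.
- apply/measurable_EFinP; apply: measurableT_comp; first exact: normr_measurable.
  by apply: measurable_funB; exact: measurable_indic.
- by apply/measurable_EFinP; exact: measurable_indic.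
move=> x _; rewrite lee_fin !indicE.
have [Sx|nSx] := boolP (x \in S).
  by case: (x \in A); case: (x \in B); rewrite ?subrr ?normr0 ?subr0 ?sub0r ?normrN ?normr1.
have -> : (x \in A) = (x \in B).
  by apply/idP/idP; rewrite !inE => /AB; apply; move/negP: nSx; rewrite inE.
by rewrite subrr normr0.
Qed.

Lemma nonincreasing_measure0 (S : nat -> set (Rn R n)) (e : R) : (0 < e)%R ->
  (forall k, measurable (S k)) -> mu (S 0%N) < +oo ->
  (forall k j, (k <= j)%N -> S j `<=` S k) ->
  (forall x, exists k, ~ S k x) ->
  exists k, mu (S k) <= e%:E.
Proof.
move=> e0 mS S0 nS S_empty.
have capS : \bigcap_k S k = set0.
  apply/seteqP; split => // x h; have [k nk] := S_empty x.
  exact/nk/(h k I).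
have H : mu (S k) @[k --> \oo] --> mu (\bigcap_k S k).
  apply: (@nonincreasing_cvg_mu _ _ _ mu S S0 mS).
    exact: bigcapT_measurable.
  by move=> k j kj; apply/subsetPset/nS.
rewrite capS measure0 in H.
apply: contrapT => /forallNP h.
have : e%:E <= limn (fun k => mu (S k)).
  apply: lime_ge; first by apply/cvg_ex; exists 0.
  by apply: nearW => k; have /negP := h k; rewrite -ltNge => /ltW.
by rewrite (cvg_lim _ H)// lee_fin leNgt e0.
Qed.

(** Intersecting with a cube keeps measures finite, so that in the countable union step of the
    Dynkin induction the remainders tend to 0 in measure. *)
Lemma ae_lebesgue_pt_Borel (r : R) E : measurable E ->
  {ae mu, forall x, Rn_lebesgue_pt (\1_((E : set (Rn R n)) `&` cube orig r) : Rn R n -> R) x}.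
Proof.
pose K := cube orig r.
have mK : measurable K by exact: measurable_cube.
have [mK' aeK] := ae_locally_constant_cube r.
have mR E' : measurable (E' : set (n.-tuple R)) -> measurable ((E' : set (Rn R n)) `&` K).
  by move=> mE'; apply: measurableI => //; exact: measurable_Rn_Borel.
have mIR E' : measurable (E' : set (n.-tuple R)) ->
    measurable_fun setT (\1_((E' : set (Rn R n)) `&` K) : Rn R n -> R).
  by move=> mE'; exact/measurable_indic/mR.
move=> mE.
have : <<s ae_locally_constant >> E by rewrite -measurable_tuple_generated.
move: E {mE}; apply: (dynkin_induction measurable_tuple_generated).
- exact: ae_locally_constantI.
- rewrite setTI; apply: filterS aeK => x; exact: locally_constant_lebesgue_pt.
- move=> E aeE; have [_ aeEK] := ae_locally_constantI aeE (ae_locally_constant_cube r).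
  by apply: filterS aeEK => x; exact: locally_constant_lebesgue_pt.
- move=> E mE aeE.
  rewrite (_ : \1_(_ `&` _) = (\1_K \+ (fun x => -1 * \1_((E : set (Rn R n)) `&` K) x))%R :> (Rn R n -> R)); last first.
    apply/funext => x; rewrite /= !indicE in_setI in_setC [in RHS]in_setI.
    by case: (x \in E); case: (x \in K); rewrite /= ?mulr0 ?mulr1 ?addr0 ?subrr.
  apply: filterS2 aeK aeE => x /locally_constant_lebesgue_pt Kx Ex.
  apply: Rn_lebesgue_ptD.
  + exact: measurable_indic.
  + by apply: measurable_funM; [exact: measurable_cst|exact: mIR].
  + exact: Kx.
  + by apply: Rn_lebesgue_ptZ; [exact: mIR|exact: Ex].
- move=> F mF tF aeF.
  (* By disjointness the indicators of partial unions are sums; inside [K] they approximate the full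
     union in L^1, which the closure property accepts. *)
  pose A m := \big[setU/set0]_(k < m) F k.
  have mA m : measurable (A m) by exact: bigsetU_measurable.
  have aeA m : {ae mu, forall x, Rn_lebesgue_pt (\1_((A m : set (Rn R n)) `&` K) : Rn R n -> R) x}.
    elim: m => [|m ih].
      rewrite /A big_ord0 set0I; apply: aeW => x.
      by rewrite indic0; exact: Rn_lebesgue_pt_cst.
    rewrite (_ : \1_(_ `&` _) = (\1_((A m : set (Rn R n)) `&` K) \+ \1_((F m : set (Rn R n)) `&` K))%R :> (Rn R n -> R)); last first.
      apply/funext => x; rewrite /A big_ord_recr/= -/(A m) !indicE !in_setI in_setU.
      have [xA|xA] := boolP (x \in A m); have [xF|xF] := boolP (x \in F m);
        case: (x \in K); rewrite /= ?addr0 ?add0r//.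
      exfalso; move: xA xF; rewrite !inE /A -bigcup_mkord => -[k /= km Fk] Fm.
      move/trivIsetP: tF => /(_ k m I I); rewrite ltn_eqF// => /(_ isT).
      move=> FkFm; have : (F k `&` F m) x by split.
      by rewrite FkFm.
    apply: filterS2 ih (aeF m) => x Ax Fx.
    by apply: Rn_lebesgue_ptD; [exact: mIR|exact: mIR|exact: Ax|exact: Fx].
  have mU : measurable (\bigcup_k F k) by exact: bigcupT_measurable.
  apply: (ae_Rn_lebesgue_pt_closed n_gt0).
    exact: mIR.
  move=> e e0.
  pose S m : set (Rn R n) := ((\bigcup_k F k) `\` A m) `&` K.
  have mS m : measurable (S m) by apply: mR; exact: measurableD.
  have [m Sm] : exists m, mu (S m) <= e%:E.
    apply: (nonincreasing_measure0 e0 mS).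
    + apply: le_lt_trans (lebesgue_Rn_cube_lty r).
      by apply: le_measure; rewrite ?inE; [exact: mS|exact: mK|exact: subIsetr].
    + move=> k j kj x [[Ux nAx] Kx]; split => //; split => // Ak; apply: nAx.
      move: Ak; rewrite /A -!bigcup_mkord => -[i /= ik Fi]; exists i => //=.
      exact: leq_trans kj.
    + move=> x; have [[k _ Fk]|nU] := pselect ((\bigcup_k F k) x).
        exists k.+1 => -[[_ nA] _]; apply: nA.
        by rewrite /A -bigcup_mkord; exists k => /=.
      by exists 0%N => -[[Ux _] _].
  exists (\1_((A m : set (Rn R n)) `&` K)); split; first exact: mIR.
    exact: aeA.
  apply: le_trans Sm; apply: integral_indic_sub_le; [exact: mR|exact: mR|exact: mS|].
  move=> x nS; split=> -[xU xK]; split => //.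
    by apply: contrapT => nA; apply: nS.
  by move: xU; rewrite /A -bigcup_mkord => -[k _ Fk]; exists k.
Qed.

End ae_lebesgue_points.

(** * From Borel sets to L^p functions, and M_t f at Lebesgue points *)

Section ae_lebesgue_points_L1.
Import HBSimple.
Context {R : realType} (n : nat).
Hypothesis n_gt0 : (0 < n)%N.
Local Notation mu := (@lebesgue_Rn R n).
Implicit Types (f g : Rn R n -> R) (x : Rn R n).
Let orig : Rn R n := [tuple 0%R | i < n].

(** The completed measure is an outer measure, an infimum over countable Borel covers; [U] is the
    union of a nearly optimal cover, and finiteness of [mu E] allows the subtraction. *)
Lemma Borel_superset (E : set (Rn R n)) (e : R) : (0 < e)%R ->
  measurable E -> mu E < +oo ->
  exists U : set (n.-tuple R), [/\ measurable U, E `<=` U, mu U < +oo &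
    mu ((U : set (Rn R n)) `\` E) <= e%:E].
Proof.
move=> e0 mE Eoo.
have Efin : mu E \is a fin_num by rewrite ge0_fin_numE.
have [_ [A [mA EA] <-] Alt] := lb_ereal_inf_adherent e0 Efin.
have mU : measurable (\bigcup_k A k) by exact: bigcupT_measurable.
have mU' : measurable ((\bigcup_k A k) : set (Rn R n)) by exact: measurable_Rn_Borel.
have Ult : mu (\bigcup_k A k) <= mu E + e%:E.
  apply: (le_trans _ (ltW Alt)); rewrite lebesgue_Rn_Borel//.
  exact: (measure_sigma_subadditive (product_lebesgue R n) mA mU).
have Uoo : mu (\bigcup_k A k) < +oo.
  by apply: (le_lt_trans Ult); rewrite -(fineK Efin) -EFinD ltry.
exists (\bigcup_k A k); split => //.
have -> : mu ((\bigcup_k A k : set (Rn R n)) `\` E) = mu (\bigcup_k A k) - mu (((\bigcup_k A k) : set (Rn R n)) `&` E).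
  exact: measureD.
by rewrite (_ : _ `&` E = E) ?leeBlDl//; apply/setIidr.
Qed.

Lemma mem_cube_orig x : exists N : nat, cube orig N%:R x.
Proof.
exists (Num.truncn (\sum_(i < n) `|tnth x i|)%R).+1 => i.
rewrite tnth_mktuple sub0r normrN.
apply: le_lt_trans (truncnS_gt _).
by rewrite (bigD1 i)//= lerDl sumr_ge0.
Qed.

Lemma cube_orig_le (r s : R) : (r <= s)%R -> cube orig r `<=` cube orig s.
Proof. by move=> rs x h i; apply: lt_le_trans (h i) rs. Qed.

(** The indicator of [U] cut by a large cube approximates that of [E] in L^1, with error [e / 2] for
    [U] minus [E] and [e / 2] for the part of [U] outside the cube. *)
Lemma ae_lebesgue_pt_finite (E : set (Rn R n)) : measurable E -> mu E < +oo ->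
  {ae mu, forall x, Rn_lebesgue_pt (\1_E : Rn R n -> R) x}.
Proof.
move=> mE Eoo; apply: (ae_Rn_lebesgue_pt_closed n_gt0).
  exact: measurable_indic.
move=> e e0; have e20 : (0 < e / 2)%R by rewrite divr_gt0.
have [U [mU EU Uoo UE]] := Borel_superset e20 mE Eoo.
have mU' : measurable (U : set (Rn R n)) by exact: measurable_Rn_Borel.
have mC (k : nat) : measurable (cube orig k%:R) by exact: measurable_cube.
pose S k := (U : set (Rn R n)) `\` cube orig k%:R.
have mS k : measurable (S k) by exact: measurableD.
have [k Sk] : exists k, mu (S k) <= (e / 2)%:E.
  apply: (nonincreasing_measure0 e20 mS).
  - by apply: le_lt_trans Uoo; apply: le_measure; rewrite ?inE; [exact: mS|exact: mU'|exact: subDsetl].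
  - move=> k j kj x [Ux nC]; split => // C; apply: nC.
    by apply: cube_orig_le C; rewrite ler_nat.
  - by move=> x; have [N xN] := mem_cube_orig x; exists N => -[].
exists (\1_((U : set (Rn R n)) `&` cube orig k%:R)); split.
- by apply: measurable_indic; exact: measurableI.
- exact: (ae_lebesgue_pt_Borel n_gt0).
have mD : measurable ((U : set (Rn R n)) `\` E) by exact: measurableD.
apply: (@le_trans _ _ (mu (((U : set (Rn R n)) `\` E) `|` S k))).
  apply: integral_indic_sub_le => //.
  - exact: measurableI.
  - exact: measurableU.
  - move=> x nS; split=> [Ex|[Ux _]].
      by split; [exact: EU|apply: contrapT => nC; apply: nS; right; split => //; exact: EU].
    by apply: contrapT => nE; apply: nS; left.
have U2 : mu (((U : set (Rn R n)) `\` E) `|` S k) <= mu ((U : set (Rn R n)) `\` E) + mu (S k).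
  exact: measureU2.
by apply: (le_trans U2); rewrite [e]splitr EFinD; exact: leeD.
Qed.

Lemma ae_lebesgue_pt_sfun (g : {sfun (Rn R n) >-> R}) :
  mu.-integrable setT (EFin \o g) -> {ae mu, forall x, Rn_lebesgue_pt g x}.
Proof.
move=> ig.
have mg : measurable_fun setT g by exact: measurable_funP.
have mgv (v : R) : measurable (g @^-1` [set v]).
  by rewrite -[X in measurable X]setTI; apply: mg.
pose F (v : R) := (fun x => v * \1_(g @^-1` [set v]) x)%R : Rn R n -> R.
have mF v : measurable_fun setT (F v).
  by apply: measurable_funM; [exact: measurable_cst|exact: measurable_indic].
have [m [v_ gE]] : exists m (v_ : 'I_m -> R), forall x, g x = (\sum_(i < m) F (v_ i) x)%R.
  by eexists; eexists => x; exact: fimfunEord.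
rewrite (_ : (g : _ -> _) = (fun x => \sum_(i < m) F (v_ i) x)%R); last exact/funext.
apply: ae_Rn_lebesgue_pt_sum => [i|i]; first exact: mF.
move: (v_ i) => v.
(* The level set of 0 may have infinite measure, but its term vanishes; the others have finite
   measure by Chebyshev's inequality. *)
have [v0|v0] := eqVneq v 0%R.
  apply: aeW => x; rewrite (_ : F v = cst 0%R); first exact: Rn_lebesgue_pt_cst.
  by apply/funext => y; rewrite /F v0 mul0r.
have vfin : mu (g @^-1` [set v]) < +oo.
  have nv0 : (0 < `|v|)%R by rewrite normr_gt0.
  have /integrableP[_ goo] := ig.
  have mEg : measurable_fun setT (EFin \o g) by exact/measurable_EFinP.
  have h : `|v|%:E * mu (setT `&` [set x | `|v|%:E <= `|(EFin \o g) x|]) < +oo.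
    exact: le_lt_trans (@le_integral_abse _ _ _ mu setT measurableT _ `|v|%R mEg nv0) goo.
  have : mu (setT `&` [set x | `|v|%:E <= `|(EFin \o g) x|]) < +oo.
    apply: contraTT h; rewrite -!leNgt !leye_eq => /eqP ->.
    by rewrite gt0_muley// lte_fin.
  apply: le_lt_trans; apply: le_measure; rewrite ?inE; [exact: mgv| |].
    apply: emeasurable_fun_c_infty; first exact: measurableT.
    by apply: measurableT_comp; [exact: abse_measurable|exact: mEg].
  by move=> x /= ->.
apply: filterS (ae_lebesgue_pt_finite (mgv v) vfin) => x vx.
by apply: Rn_lebesgue_ptZ; [exact: measurable_indic|exact: vx].
Qed.

Lemma ae_lebesgue_pt_integrable f :
  mu.-integrable setT (EFin \o f) -> {ae mu, forall x, Rn_lebesgue_pt f x}.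
Proof.
move=> fi.
have mf : measurable_fun setT f by apply/measurable_EFinP; case/integrableP: fi.
apply: (ae_Rn_lebesgue_pt_closed n_gt0); first exact: mf.
move=> e e0.
have [g_ [gi _ gf]] := approximation_sfun_integrable measurableT fi.
have [k gk] : exists k, \int[mu]_x `|(f x)%:E - (g_ k x)%:E| <= e%:E.
  apply: contrapT => /forallNP h.
  have : e%:E <= limn (fun k => \int[mu]_x `|(f x)%:E - (g_ k x)%:E|).
    apply: lime_ge; first by apply/cvg_ex; exists 0.
    by apply: nearW => k; have /negP := h k; rewrite -ltNge => /ltW.
  by rewrite (cvg_lim _ gf)// lee_fin leNgt e0.
exists (g_ k); split.
- exact: measurable_funP.
- exact: ae_lebesgue_pt_sfun.
- exact: gk.
Qed.

(** Being a Lebesgue point is a local property, and on a cube [|f| <= 1 + |f|^p] makes [f]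
    integrable. *)
Lemma ae_lebesgue_pt_Lp f (p : R) : (1 < p)%R -> measurable_fun setT f ->
  \int[mu]_x (`|f x| `^ p)%:E < +oo -> {ae mu, forall x, Rn_lebesgue_pt f x}.
Proof.
move=> p1 mf fp.
have mnf : measurable_fun setT (fun x => `|f x|%R).
  by apply: measurableT_comp; [exact: normr_measurable|exact: mf].
have mfp : measurable_fun setT (fun x => (`|f x| `^ p)%:E).
  by apply/measurable_EFinP; exact: (measurableT_comp (measurable_powR p) mnf).
(* With [k.+1], the ball of radius 1 around a point of the cube of half-side [k] stays where [f_ k]
   equals [f]. *)
pose f_ (k : nat) : Rn R n -> R := (f \* \1_(cube orig k.+1%:R))%R.
have mC (k : nat) : measurable (cube orig k%:R) by exact: measurable_cube.
have m1 (k : nat) : measurable_fun setT (\1_(cube orig k%:R) : Rn R n -> R).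
  exact: measurable_indic.
have mf_ k : measurable_fun setT (f_ k) by apply: measurable_funM; [exact: mf|exact: m1].
have fi k : mu.-integrable setT (EFin \o f_ k).
  apply/integrableP; split; first exact/measurable_EFinP.
  apply: (@le_lt_trans _ _ (\int[mu]_x ((\1_(cube orig k.+1%:R) x)%:E + (`|f x| `^ p)%:E))).
    apply: ge0_le_integral.
    - exact: measurableT.
    - by move=> x _; exact: abse_ge0.
    - by apply: measurableT_comp; [exact: abse_measurable|exact/measurable_EFinP].
    - by apply: emeasurable_funD; [apply/measurable_EFinP; exact: m1|exact: mfp].
    move=> x _; rewrite /f_ /= -EFinD lee_fin indicE normrM.
    case: (x \in _) => /=; last by rewrite normr0 mulr0 add0r powR_ge0.
    rewrite normr1 mulr1; have [f1|f1] := leP `|f x|%R 1%R.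
      by rewrite (le_trans f1)// lerDl powR_ge0.
    by rewrite ler_wpDl// -{1}[`|f x|%R]powRr1// ler_powR ?ltW.
  rewrite ge0_integralD; last 5 first.
  - exact: measurableT.
  - by move=> x _; rewrite lee_fin.
  - by apply/measurable_EFinP; exact: m1.
  - by move=> x _; rewrite lee_fin powR_ge0.
  - exact: mfp.
  rewrite lte_add_pinfty//.
  rewrite integral_indic; [|exact: measurableT|exact: mC].
  by rewrite setIT; exact: lebesgue_Rn_cube_lty.
have : {ae mu, forall x k, Rn_lebesgue_pt (f_ k) x}.
  by apply/ae_foralln => k; exact: ae_lebesgue_pt_integrable.
apply: filterS => x fx; have [N xN] := mem_cube_orig x.
apply: Rn_lebesgue_pt_local (fx N); exists 1%R => // y /euclidean_ball_sub_cube xy.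
rewrite /f_ /= indicE mem_set ?mulr1// => i.
have := xN i; have := xy i; rewrite tnth_mktuple !sub0r !normrN -natr1.
rewrite ltr_norml => /andP[h1 h2]; rewrite !ltr_norml => /andP[h3 h4].
by apply/andP; split; lra.
Qed.

Lemma lebesgue_pt_maximal_le f x (e : R) : measurable_fun setT f -> (0 < e)%R ->
  Rn_lebesgue_pt f x ->
  exists2 d : R, (0 < d)%R & forall t, (t <= d)%R ->
    truncated_HL_maximal t f x <= (`|f x| + e)%:E.
Proof.
move=> mf e0 fx; have [d d0 H] := fx e e0; exists d => // t td.
rewrite leNgt; apply/negP => /(gt_truncated_HL_maximal n_gt0)[r /andP[r0 rt]].
apply/negP; rewrite -leNgt.
have mB := measurable_euclidean_ball x r.
apply: (@le_trans _ _ (\int[mu]_(y in euclidean_ball x r) (`|f y - f x|%:E + `|f x|%:E))).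
  apply: ge0_le_integral.
  - exact: mB.
  - by move=> y _; rewrite lee_fin.
  - have := @measurable_abse_sub _ _ f 0%R (euclidean_ball x r) mf.
    by under eq_fun do rewrite subr0.
  - by apply: emeasurable_funD; [exact: measurable_abse_sub|exact: measurable_cst].
  - move=> y _; rewrite -EFinD lee_fin -{1}[f y](subrK (f x)); exact: ler_normD.
rewrite ge0_integralD; last 5 first.
- exact: mB.
- by move=> y _; rewrite lee_fin.
- exact: measurable_abse_sub.
- by move=> y _; rewrite lee_fin.
- exact: measurable_cst.
rewrite integral_cst; last exact: mB.
rewrite [leRHS]muleC EFinD ge0_muleDl ?lee_fin ?(ltW e0)// addeC; apply: leeD => //.
by apply: H; rewrite r0 (le_trans rt).
Qed.

Lemma lebesgue_pt_maximal_ge f x (t : R) : measurable_fun setT f -> (0 < t)%R ->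
  Rn_lebesgue_pt f x -> `|f x|%:E <= truncated_HL_maximal t f x.
Proof.
move=> mf t0 fx; apply/lee_addgt0Pr => e e0; have [d d0 H] := fx e e0.
rewrite leNgt; apply/negP => h.
pose r := Num.min d t.
have r0 : (0 < r)%R by rewrite lt_min d0.
have mB := measurable_euclidean_ball x r.
have v0 := lebesgue_Rn_euclidean_ball_gt0 n_gt0 x r0.
have vf := lebesgue_Rn_euclidean_ball_fin x r.
have Hr := H r; rewrite r0 ge_min lexx in Hr; have {}Hr := Hr isT.
have Mr : \int[mu]_(y in euclidean_ball x r) `|f y|%:E <=
    mu (euclidean_ball x r) * truncated_HL_maximal t f x.
  rewrite leNgt; apply/negP => h'.
  (* The description of superlevel sets is applied with the supremum itself as the level. *)
  have : truncated_HL_maximal t f x < truncated_HL_maximal t f x.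
    apply/(gt_truncated_HL_maximal n_gt0); exists r => //.
    by rewrite r0 ge_min lexx orbT.
  by rewrite ltxx.
have mfE : measurable_fun (euclidean_ball x r) (fun y => `|f y|%:E).
  have := @measurable_abse_sub _ _ f 0%R (euclidean_ball x r) mf.
  by under eq_fun do rewrite subr0.
have : `|f x|%:E * mu (euclidean_ball x r) <=
    \int[mu]_(y in euclidean_ball x r) `|f y|%:E +
    \int[mu]_(y in euclidean_ball x r) `|f y - f x|%:E.
  rewrite -integral_cst; last exact: mB.
  rewrite -ge0_integralD; last 5 first.
  - exact: mB.
  - by move=> y _; rewrite lee_fin.
  - exact: mfE.
  - by move=> y _; rewrite lee_fin.
  - exact: measurable_abse_sub.
  apply: ge0_le_integral.
  - exact: mB.
  - by move=> y _; rewrite lee_fin.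
  - exact: measurable_cst.
  - by apply: emeasurable_funD; [exact: mfE|exact: measurable_abse_sub].
  - move=> y _; rewrite -EFinD lee_fin -{1}(subKr (f y) (f x)); exact: ler_normB.
move=> /le_trans/(_ (leeD Mr Hr)).
have M0 := truncated_HL_maximal_ge0 f x t0.
move: h vf v0 M0; case: (mu _) => // v; case: (truncated_HL_maximal t f x) => // m.
rewrite -EFinD lte_fin => h _; rewrite lte_fin => v0 _.
rewrite -!EFinM -EFinD lee_fin leNgt => /negP; apply.
by rewrite (mulrC e) -mulrDr [X in (_ < X)%R]mulrC ltr_pM2l.
Qed.

End ae_lebesgue_points_L1.

(** * The limit *)

Section maximal_norm_limit.
Context {R : realType} (n : nat).
Hypothesis n_gt0 : (0 < n)%N.
Local Notation mu := (@lebesgue_Rn R n).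

Lemma truncated_HL_maximal_le (t t' : R) (f : Rn R n -> R) x : (t <= t')%R ->
  truncated_HL_maximal t f x <= truncated_HL_maximal t' f x.
Proof.
move=> tt'; apply: le_ereal_sup => _ [r /= + <-].
rewrite in_itv/= => /andP[r0 rt]; exists r => //=.
by rewrite in_itv/= r0 (le_trans rt).
Qed.

Lemma ge0_le_poweR (p : R) (a b : \bar R) : (0 <= p)%R -> 0 <= a -> a <= b ->
  a `^ p <= b `^ p.
Proof.
move=> p0 a0 ab; apply: gt0_ler_poweR => //; rewrite in_itv/= leey andbT//.
exact: le_trans ab.
Qed.

(** Turns M_t f <= |f| + d into a bound by [|f|^p + e] after taking powers. At [u = 0], where
    continuity is not at hand, [d = e^(1/p)] is explicit. *)
Lemma powR_right_continuous (p u e : R) : (0 < p)%R -> (0 <= u)%R -> (0 < e)%R ->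
  exists2 d : R, (0 < d)%R & ((u + d) `^ p <= u `^ p + e)%R.
Proof.
move=> p0; rewrite le_eqVlt => /predU1P[<-|u0] e0.
  exists (e `^ p^-1)%R; first exact: powR_gt0.
  rewrite add0r -powRrM mulVf ?gt_eqF// powRr1 ?(ltW e0)//.
  by rewrite lerDr powR_ge0.
have /cvgrPdist_le/(_ e e0) := @continuous_powR R p u u0.
move=> /nbhs_ballP[d /= d0 H]; exists (d / 2)%R; first by rewrite divr_gt0.
have /H : ball u d (u + d / 2)%R.
  by rewrite /ball/= opprD addrA subrr sub0r normrN gtr0_norm ?divr_gt0//; lra.
by rewrite ler_distlC => /andP[_].
Qed.

Lemma integral_poweR_maximal_cvg (p : R) (f : Rn R n -> R) : (1 < p)%R ->
  measurable_fun setT f -> \int[mu]_x (`|f x| `^ p)%:E < +oo ->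
  \int[mu]_x (truncated_HL_maximal k.+1%:R^-1 f x `^ p) @[k --> \oo] -->
  \int[mu]_x (`|f x| `^ p)%:E.
Proof.
move=> p1 mf fp; have p0 : (0 < p)%R by lra.
have aef := ae_lebesgue_pt_Lp n_gt0 p1 mf fp.
have mM t : measurable_fun setT (fun x => truncated_HL_maximal t f x `^ p).
  have := measurable_truncated_HL_maximal n_gt0 t mf.
  by move/(measurableT_comp (measurable_poweR p)).
have mnf : measurable_fun setT (fun x => `|f x|%R).
  by apply: measurableT_comp; [exact: normr_measurable|exact: mf].
have k0 k : (0 < k.+1%:R^-1 :> R)%R by [].
have k1 k : (k.+1%:R^-1 <= 1 :> R)%R by rewrite invf_le1// ler1n.
have M0 k x : 0 <= truncated_HL_maximal k.+1%:R^-1 f x.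
  exact: truncated_HL_maximal_ge0.
have [C C0 strong] := HL_maximal_strong_type n_gt0 p1.
have mfp : measurable_fun setT (fun x => (`|f x| `^ p)%:E).
  by apply/measurable_EFinP; exact: (measurableT_comp (measurable_powR p) mnf).
have cvgM : {ae mu, forall x, [set: Rn R n] x ->
    truncated_HL_maximal k.+1%:R^-1 f x `^ p @[k --> \oo] --> (`|f x| `^ p)%:E}.
  apply: filterS aef => x fx _.
  (* The sequence is nonincreasing, so it converges to its infimum; for each [e] a single index
     bounds that infimum from above. *)
  have := @ereal_nonincreasing_cvgn _ (fun k => truncated_HL_maximal k.+1%:R^-1 f x `^ p).
  rewrite (_ : ereal_inf _ = (`|f x| `^ p)%:E).
    apply => k j kj; apply: ge0_le_poweR; [exact: ltW|exact: M0|].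
    by apply: truncated_HL_maximal_le; rewrite lef_pV2 ?posrE// ler_nat.
  apply/eqP; rewrite eq_le; apply/andP; split; last first.
    apply: le_ereal_inf_tmp => _ [k _ <-]; rewrite -poweR_EFin.
    by apply: ge0_le_poweR; [exact: ltW|rewrite lee_fin|exact: lebesgue_pt_maximal_ge].
  apply/lee_addgt0Pr => e e0.
  have [d d0 hd] := powR_right_continuous p0 (normr_ge0 (f x)) e0.
  have [r r0 hr] := lebesgue_pt_maximal_le n_gt0 mf d0 fx.
  have [k _ /(_ k (leqnn _)) /= kr] := near_infty_natSinv_lt (PosNum r0).
  apply: (@le_trans _ _ (truncated_HL_maximal k.+1%:R^-1 f x `^ p)).
    by apply: ereal_inf_lbound; exists k.
  apply: (@le_trans _ _ ((`|f x| + d)%:E `^ p)).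
    by apply: ge0_le_poweR; [exact: ltW|exact: M0|exact/hr/ltW].
  by rewrite poweR_EFin -EFinD lee_fin.
have iM : mu.-integrable setT (fun x => truncated_HL_maximal 1 f x `^ p).
  apply/integrableP; split; first exact: mM.
  under eq_integral do rewrite gee0_abs ?poweR_ge0//.
  apply: le_lt_trans (strong 1%R f mf _) _; first by rewrite ltr01 lexx.
  by rewrite lte_mul_pinfty// lee_fin ltW.
have domM : {ae mu, forall x k, [set: Rn R n] x ->
    `|truncated_HL_maximal k.+1%:R^-1 f x `^ p| <= truncated_HL_maximal 1 f x `^ p}.
  apply: aeW => x k _; rewrite gee0_abs ?poweR_ge0//.
  apply: ge0_le_poweR; [exact: ltW|exact: M0|].
  exact: truncated_HL_maximal_le.
by have [_ _] := dominated_convergence measurableT (fun k => mM (k.+1%:R^-1)%R) mfp cvgM iM domM.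
Qed.

End maximal_norm_limit.

(** * Averages against power weights and the conclusion *)

Lemma integral_powR01 (R : realType) (s : R) : (0 < s)%R ->
  \int[@lebesgue_measure R]_(t in `]0%R, 1%R[) (t `^ (s - 1))%:E = (s^-1)%:E.
Proof.
move=> s0; have := @integral_powR R s 1%R s0 ler01; rewrite powR1.
have -> : \int[@lebesgue_measure R]_(t in `]0%R, 1%R[) (s * t `^ (s - 1))%:E =
    s%:E * \int[@lebesgue_measure R]_(t in `]0%R, 1%R[) (t `^ (s - 1))%:E.
  rewrite -ge0_integralZl; last 4 first.
  - exact: measurable_itv.
  - by apply: measurable_funTS; apply/measurable_EFinP; exact: measurable_powR.
  - by move=> t _; rewrite lee_fin powR_ge0.
  - by rewrite lee_fin ltW.
  by apply: eq_integral => t _; rewrite EFinM.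
case: (\int[_]_(_ in _) _) => [v| |].
- rewrite -EFinM => -[sv]; congr EFin; apply: (mulfI (lt0r_neq0 s0)).
  by rewrite sv mulfV// gt_eqF.
- by rewrite gt0_muley.
- by rewrite gt0_muleNy.
Qed.

(* A power weight [a t^(a q - 1)] concentrates at the origin as [a -> 0+]. *)
Lemma cvg_power_average (R : realType) (q L : R) (N : R -> \bar R) : (0 < q)%R ->
  (forall t, (0 < t <= 1)%R -> L%:E <= N t) -> (0 <= L)%R -> N 1%R < +oo ->
  (forall t t', (0 < t)%R -> (t <= t' <= 1)%R -> N t <= N t') ->
  (forall e : R, (0 < e)%R -> exists2 d, (0 < d <= 1)%R & N d <= (L + e)%:E) ->
  alpha%:E * \int[@lebesgue_measure R]_(t in `]0%R, 1%R[)
      ((t `^ (alpha * q - 1))%:E * N t) @[alpha --> 0%R^'+] --> (q^-1 * L)%:E.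
Proof.
move=> q0 LN L0 N1 ndN Nd.
have Nfin t : (0 < t <= 1)%R -> N t \is a fin_num.
  move=> /andP[t0 t1]; rewrite ge0_fin_numE.
    by apply: le_lt_trans N1; apply: ndN => //; rewrite t1 lexx.
  by apply: le_trans (LN t _); rewrite ?lee_fin// t0.
have N1E : N 1%R = (fine (N 1%R))%:E by rewrite fineK// Nfin// ltr01 lexx.
have K0 : (0 <= fine (N 1%R))%R.
  by rewrite -lee_fin -N1E (le_trans _ (LN 1%R _)) ?lee_fin// ltr01 lexx.
have mN : measurable_fun (`]0%R, 1%R[%classic : set R) N.
  (* Monotonicity gives measurability: [g] extends [N] to a nondecreasing real function on the line,
     0 up to 0 and constant from 1 on. *)
  pose g (t : R) := if (t <= 0)%R then 0%R else fine (N (Num.min t 1%R)).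
  have mg : measurable_fun (`]0%R, 1%R[%classic : set R) g.
    apply: nondecreasing_measurable => // s t st; rewrite /g.
    have [s0|s0] := leP s 0%R; have [t0|t0] := leP t 0%R => //.
    - rewrite -lee_fin fineK; last by rewrite Nfin// ge_min lexx orbT lt_min t0 ltr01.
      by apply: le_trans (LN _ _); rewrite ?lee_fin// ge_min lexx orbT lt_min t0 ltr01.
    - by move: (lt_le_trans s0 st); rewrite ltNge t0.
    - rewrite -lee_fin !fineK; last 2 first.
        by rewrite Nfin// ge_min lexx orbT lt_min t0 ltr01.
        by rewrite Nfin// ge_min lexx orbT lt_min s0 ltr01.
      apply: ndN; first by rewrite lt_min s0 ltr01.
      apply/andP; split; last by rewrite ge_min lexx orbT.
      by rewrite le_min !ge_min st lexx orbT.
  apply: (eq_measurable_fun (EFin \o g)); last exact/measurable_EFinP.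
  move=> t; rewrite inE/= in_itv/= => /andP[t0 t1].
  rewrite /g leNgt t0/= min_l ?ltW// fineK// Nfin// t0 ltW//.
have mp (r : R) D : measurable_fun D (fun t : R => (t `^ r)%:E).
  by apply: measurable_funTS; apply/measurable_EFinP; exact: measurable_powR.
have N0 (t : R) : `]0%R, 1%R[%classic t -> 0 <= N t.
  rewrite /= in_itv/= => /andP[t0 t1]; apply: le_trans (LN t _); rewrite ?lee_fin//.
  by rewrite t0 ltW.
have lower a : (0 < a)%R -> (q^-1 * L)%:E <=
    a%:E * \int[@lebesgue_measure R]_(t in `]0%R, 1%R[) ((t `^ (a * q - 1))%:E * N t).
  move=> a0; have aq0 : (0 < a * q)%R by rewrite mulr_gt0.
  apply: (@le_trans _ _ (a%:E * \int[@lebesgue_measure R]_(t in `]0%R, 1%R[)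
      ((t `^ (a * q - 1))%:E * L%:E))).
    rewrite ge0_integralZr; last 4 first.
    - exact: measurable_itv.
    - exact: mp.
    - by move=> t _; rewrite lee_fin powR_ge0.
    - by rewrite lee_fin.
    rewrite integral_powR01// -!EFinM lee_fin invfM !mulrA mulfV ?gt_eqF// mul1r//.
  apply: lee_wpmul2l; first by rewrite lee_fin ltW.
  apply: ge0_le_integral.
  - exact: measurable_itv.
  - by move=> t _; rewrite mule_ge0// lee_fin ?powR_ge0.
  - by apply: emeasurable_funM; [exact: mp|exact: measurable_cst].
  - by apply: emeasurable_funM; [exact: mp|exact: mN].
  - move=> t; rewrite /= in_itv/= => /andP[t0 t1].
    by apply: lee_wpmul2l; [rewrite lee_fin powR_ge0|apply: LN; rewrite t0 ltW].
(* Up to [d], [N] is at most [L + e]. Beyond [d], [t^(a q - 1) <= 1 / t <= 1 / d] and [N t <= N 1],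
   so a constant covers the rest. *)
have upper a d e : (0 < a)%R -> (0 < d <= 1)%R -> N d <= (L + e)%:E ->
    a%:E * \int[@lebesgue_measure R]_(t in `]0%R, 1%R[) ((t `^ (a * q - 1))%:E * N t) <=
    (q^-1 * (L + e) + a * (d^-1 * fine (N 1%R)))%:E.
  move=> a0 /andP[d0 d1] Nde; have aq0 : (0 < a * q)%R by rewrite mulr_gt0.
  have Le0 : (0 <= L + e)%R.
    by rewrite -lee_fin (le_trans _ Nde)// (le_trans _ (LN d _)) ?lee_fin// d0.
  have dK0 : (0 <= d^-1 * fine (N 1%R))%R by rewrite mulr_ge0// invr_ge0 ltW.
  apply: (@le_trans _ _ (a%:E * \int[@lebesgue_measure R]_(t in `]0%R, 1%R[)
      ((t `^ (a * q - 1))%:E * (L + e)%:E + (d^-1 * fine (N 1%R))%:E))).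
    apply: lee_wpmul2l; first by rewrite lee_fin ltW.
    apply: ge0_le_integral.
    - exact: measurable_itv.
    - by move=> t t01; rewrite mule_ge0 ?lee_fin ?powR_ge0// N0.
    - by apply: emeasurable_funM; [exact: mp|exact: mN].
    - apply: emeasurable_funD; last exact: measurable_cst.
      by apply: emeasurable_funM; [exact: mp|exact: measurable_cst].
    - move=> t; rewrite /= in_itv/= => /andP[t0 t1].
      have [td|dt] := leP t d.
        apply: (@le_trans _ _ ((t `^ (a * q - 1))%:E * (L + e)%:E)); last first.
          by apply: leeDl; rewrite lee_fin.
        apply: lee_wpmul2l; first by rewrite lee_fin powR_ge0.
        by apply: le_trans Nde; apply: ndN => //; rewrite td d1.
      apply: (@le_trans _ _ (d^-1 * fine (N 1%R))%:E); last first.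
        by apply: leeDr; rewrite mule_ge0 ?lee_fin ?powR_ge0.
      rewrite EFinM -N1E; apply: lee_pmul.
      + by rewrite lee_fin powR_ge0.
      + by apply: N0; rewrite /= in_itv/= t0.
      + rewrite lee_fin powRD; last by rewrite (gt_eqF t0) implybT.
        rewrite powR_inv1 ?(ltW t0)// -[leRHS]mul1r; apply: ler_pM.
        * exact: powR_ge0.
        * by rewrite invr_ge0 ltW.
        * have -> : (1 = 1 `^ (a * q) :> R)%R by rewrite powR1.
          by apply: ge0_ler_powR; rewrite ?nnegrE ?ltW.
        * by rewrite lef_pV2 ?posrE// ltW.
      + by apply: ndN => //; rewrite (ltW t1) lexx.
  rewrite ge0_integralD; last 5 first.
  - exact: measurable_itv.
  - by move=> t _; rewrite mule_ge0 ?lee_fin ?powR_ge0.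
  - by apply: emeasurable_funM; [exact: mp|exact: measurable_cst].
  - by move=> t _; rewrite lee_fin.
  - exact: measurable_cst.
  rewrite ge0_integralZr; last 4 first.
    - exact: measurable_itv.
    - exact: mp.
    - by move=> t _; rewrite lee_fin powR_ge0.
    - by rewrite lee_fin.
  rewrite integral_powR01// integral_cst//= lebesgue_measure_itv/= lte_fin ltr01.
  rewrite oppr0 adde0 mule1 -!EFinM lee_fin mulrDr invfM !mulrA mulfV ?gt_eqF//.
  by rewrite mul1r.
apply/fine_cvgP; split.
  near=> a; have a0 : (0 < a)%R by near: a; exact: nbhs_right_gt.
  have [d d01 Nde] := Nd 1%R ltr01.
  rewrite ge0_fin_numE; first exact: le_lt_trans (upper a d 1%R a0 d01 Nde) (ltry _).
  by apply: le_trans (lower a a0); rewrite lee_fin mulr_ge0// invr_ge0 ltW.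
apply/cvgrPdist_le => e e0.
(* This excess over [L] contributes [e / 2] after division by [q]; the remaining [e / 2] pays for
   the constant term once [a < e / 2 / K]. The added 1 keeps [K] positive even if [N 1] is 0. *)
have eq0 : (0 < e * q / 2)%R by rewrite divr_gt0// mulr_gt0.
have [d d01 Nde] := Nd _ eq0.
pose K : R := (d^-1 * fine (N 1%R) + 1)%R.
have dK0 : (0 <= d^-1 * fine (N 1%R))%R.
  by case/andP: d01 => d0 _; rewrite mulr_ge0// invr_ge0 ltW.
have K1 : (0 < K)%R by rewrite ltr_wpDl.
near=> a; have a0 : (0 < a)%R by near: a; exact: nbhs_right_gt.
have aK : (a < e / 2 / K)%R.
  by near: a; apply: nbhs_right_lt; rewrite !divr_gt0.
have lo := lower a a0; have up := upper a d _ a0 d01 Nde.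
move: lo up; rewrite /=; set J := (_ * integral _ _ _).
case: J => [j| |]; rewrite ?leNye ?leye_eq// !lee_fin /= => lo up.
rewrite ler_distlC; apply/andP; split; first by rewrite (le_trans _ lo)// gerBl ltW.
apply: (le_trans up); rewrite mulrDr -addrA lerD2l.
have -> : (q^-1 * (e * q / 2) = e / 2)%R by field; rewrite gt_eqF.
rewrite [leRHS]splitr lerD2l.
apply: (@le_trans _ _ (a * K)%R); first by rewrite ler_pM2l// lerDl.
by rewrite -ler_pdivlMr// ltW.
Unshelve. all: by end_near. Qed.

(** The averaging statement with [q = p / 2], whence the factor [1 / q = 2 / p]. *)
Theorem mainTheorem6 (R : realType) (n : nat) (p : R)
    (n_gt0 : (0 < n)%N) (p_gt1 : (1 < p)%R)
    (f : Rn R n -> R) (fLp : f \in Lfun (@lebesgue_Rn R n) p%:E) :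
  alpha%:E * \int[@lebesgue_measure R]_(t in `]0%R, 1%R[)
      ((t `^ (alpha * p / 2 - 1))%:E
       * 'N[@lebesgue_Rn R n]_p%:E [truncated_HL_maximal t f] `^ p)
    @[alpha --> 0%R^'+]
  --> (2 / p)%:E * 'N[@lebesgue_Rn R n]_p%:E [EFin \o f] `^ p.
Proof.
pose mu := @lebesgue_Rn R n.
have p0 : (0 < p)%R by exact: lt_trans p_gt1.
have pn0 : p != 0%R by rewrite gt_eqF.
have mf : measurable_fun setT f by move/sub_Lfun_mfun: fLp; rewrite inE.
have fp : 'N[mu]_p%:E [EFin \o f] `^ p = \int[mu]_x (`|f x| `^ p)%:E.
  by rewrite poweR_Lnorm//; apply: eq_integral => x _; rewrite -poweR_EFin.
have foo : \int[mu]_x (`|f x| `^ p)%:E < +oo.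
  by rewrite -fp poweR_lty//; move/sub_Lfun_finLfun: fLp; rewrite inE.
have NE t : (0 < t)%R -> 'N[mu]_p%:E [truncated_HL_maximal t f] `^ p =
    \int[mu]_x (truncated_HL_maximal t f x `^ p).
  move=> t0; rewrite poweR_Lnorm//; apply: eq_integral => x _.
  by rewrite gee0_abs//; exact: truncated_HL_maximal_ge0.
have mMp t : measurable_fun setT (fun x => truncated_HL_maximal t f x `^ p).
  have := measurable_truncated_HL_maximal n_gt0 t mf.
  by move/(measurableT_comp (measurable_poweR p)).
have mnf : measurable_fun setT (fun x => `|f x|%R).
  by apply: measurableT_comp; [exact: normr_measurable|exact: mf].
have f0 : 0 <= \int[mu]_x (`|f x| `^ p)%:E.
  by apply: integral_ge0 => x _; rewrite lee_fin powR_ge0.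
have ffin : \int[mu]_x (`|f x| `^ p)%:E = (fine (\int[mu]_x (`|f x| `^ p)%:E))%:E.
  by rewrite fineK// ge0_fin_numE.
have q0 : (0 < p / 2)%R by rewrite divr_gt0.
rewrite fp ffin -EFinM -[(2 / p)%R]invf_div.
rewrite (_ : (fun alpha : R => _) = (fun alpha : R => alpha%:E *
  \int[@lebesgue_measure R]_(t in `]0%R, 1%R[) ((t `^ (alpha * (p / 2) - 1))%:E *
    'N[mu]_p%:E [truncated_HL_maximal t f] `^ p))); last first.
  by apply/funext => a; rewrite mulrA.
apply: cvg_power_average => //.
- move=> t /andP[t0 t1]; rewrite -ffin NE//; apply: ae_ge0_le_integral.
  + exact: measurableT.
  + by move=> x _; rewrite lee_fin powR_ge0.
  + by apply/measurable_EFinP; exact: (measurableT_comp (measurable_powR p) mnf).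
  + by move=> x _; exact: poweR_ge0.
  + exact: mMp.
  + apply: filterS (ae_lebesgue_pt_Lp n_gt0 p_gt1 mf foo) => x fx _.
    rewrite -poweR_EFin; apply: ge0_le_poweR; [exact: ltW|by rewrite lee_fin|].
    exact: lebesgue_pt_maximal_ge.
- exact: fine_ge0.
- rewrite NE//; have [C C0 strong] := HL_maximal_strong_type n_gt0 p_gt1.
  apply: le_lt_trans (strong 1%R f mf _) _; first by rewrite ltr01 lexx.
  by rewrite lte_mul_pinfty// lee_fin ltW.
- move=> t t' t0 /andP[tt' t1]; rewrite !NE ?(lt_le_trans t0)//.
  apply: ge0_le_integral.
  + exact: measurableT.
  + by move=> x _; exact: poweR_ge0.
  + exact: mMp.
  + exact: mMp.
  + move=> x _; apply: ge0_le_poweR; [exact: ltW|exact: truncated_HL_maximal_ge0|].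
    exact: truncated_HL_maximal_le.
- move=> e e0; have cvgN := integral_poweR_maximal_cvg n_gt0 p_gt1 mf foo.
  (* If no [d] brought [N d] below [L + e], all terms along [1 / (k + 1)] would exceed it, and so
     would their limit [L]. *)
  apply: contrapT => h.
  have : (fine (\int[mu]_x (`|f x| `^ p)%:E) + e)%:E <=
      limn (fun k => \int[mu]_x (truncated_HL_maximal k.+1%:R^-1 f x `^ p)).
    apply: lime_ge; first by apply/cvg_ex; eexists; exact: cvgN.
    apply: nearW => k; rewrite leNgt; apply/negP => hk; apply: h.
    exists k.+1%:R^-1%R; first by rewrite invr_gt0 ltr0n/= invf_le1// ler1n.
    by rewrite NE ?invr_gt0// ltW.
  by rewrite (cvg_lim _ cvgN)// ffin lee_fin gerDl leNgt e0.
Qed.
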